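(* Let $A$ be an infimum groupoid atlas such that every local groupoid $\mathcal G_\alpha$ of $A$ is simply connected, and let $x\in X_A$. Then the canonical homomorphism $p:\pi_1(A,x)\to\pi_1^w(A,x)$ from the strong to the weak fundamental group is an isomorphism.
   Context: A groupoid atlas $A=(X_A,\phi_A,\mathcal G_A)$ consists of a set $X_A$, an index set $\phi_A$ with a reflexive relation $\leqslant$, and for each $\alpha\in\phi_A$ a groupoid $\mathcal G_\alpha$ (a local groupoid) with object set $X_\alpha\subset X_A$, such that if $\alpha\leqslant\beta$ then $X_\alpha\cap X_\beta$ is a union of connected components of $\mathcal G_\alpha$ and a functor $\phi_\alpha^\beta:\mathcal G_\alpha|_{X_\alpha\cap X_\beta}\to\mathcal G_\beta|_{X_\alpha\cap X_\beta}$ which is the identity on objects is given ($\mathcal G|_X$ is the full subgroupoid on $X$); $\phi_\alpha^\alpha=\mathrm{id}$ and $\phi_\beta^\gamma\circ\phi_\alpha^\beta=\phi_\alpha^\gamma$ whenever defined. All atlases are assumed covered: $X_A=\bigcup_\alpha X_\alpha$. A local groupoid is simply connected if all its vertex groups are trivial, i.e. there is at most one arrow between any two objects; it is not required to be connected. A local frame is a nonempty finite subset of (the object set of) a connected component of some local groupoid. $A$ is infimum if for every local frame $s$ the set $\phi_s=\{\alpha\in\phi_A : s\subset X_\alpha\}$ has an initial element (an $\alpha\in\phi_s$ with $\alpha\leqslant\beta$ for all $\beta\in\phi_s$). An infimum atlas is good: each $\phi_x=\{\alpha : x\in X_\alpha\}$ has an initial element. A morphism $f:A\to B$ is a triple $(X_f,\phi_f,\mathcal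 G_f)$ with $X_f:X_A\to X_B$ a function, $\phi_f:\phi_A\to\phi_B$ a function preserving $\leqslant$, and functors $\mathcal G_f(\alpha):\mathcal G_\alpha\to\mathcal G_{\phi_f(\alpha)}$ which are $X_f|_{X_\alpha}$ on objects and commute with the structural functors. For $f,f':A\to B$, $f\lhd f'$ means that $\phi_f(\alpha)\leqslant\phi_{f'}(\alpha)$ and $\phi_{\phi_f(\alpha)}^{\phi_{f'}(\alpha)}\circ\mathcal G_f(\alpha)=\mathcal G_{f'}(\alpha)$ for all $\alpha$; $\sim$ is the equivalence relation generated by $\lhd$, and $[f]$ is the class of $f$. The product $A\times B$ has underlying set $X_A\times X_B$, index set $\phi_A\times\phi_B$ with the product relation, and local groupoids $\mathcal G_\alpha\times\mathcal G_\beta$. The line $L$ is the atlas with $X_L=\mathbb Z$, index set the subsets $\{n\}$ and $\{n,n+1\}$ of $\mathbb Z$ ordered by inclusion, and $\mathcal G_s$ the groupoid with object set $s$ and exactly one arrow between any two objects; structural functors are inclusions. For $\lambda:L\to A$ let $\lambda_n$ be the local arrow $\mathcal G_\lambda(\{n,n+1\})(n\to n+1)$. $\lambda$ stabilizes to the left (right) if there are $x\in X_A$, $\alpha\in\phi_A$ with $\lambda_n=\mathrm{id}_x\in\mathcal G_\alpha$ for all small (big) enough $n$. A path is a class $[\lambda]$ of a morphism $\lambda:L\to A$ which stabilizes in both directions; a loop at $x$ is a path whose eventual values to the left and right are both $x$. A homotopy between paths $l,l'$ is a morphism $H:L\times L\to A$ for which there are integers $N_0,N_1,M_0,M_1$ and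 $\alpha_0,\alpha_1\in\phi_A$ such that $[H\circ j_{N_0}]=l$, $[H\circ j_{N_1}]=l'$, where $j_N:L\to L\times L$ is the inclusion $n\mapsto(n,N)$, $s\mapsto(s,\{N\})$, and for every local arrow $f$ of $L\times L$, $\mathcal G_H(f)=\mathrm{id}_{x_0}\in\mathcal G_{\alpha_0}$ if the first coordinate of the source of $f$ is less than $M_0$, and $\mathcal G_H(f)=\mathrm{id}_{x_1}\in\mathcal G_{\alpha_1}$ if the first coordinate of the target of $f$ is greater than $M_1$ (where $x_0,x_1$ are the endpoints). $\pi_1(A,x)$ is the set of homotopy classes of loops at $x$ with multiplication induced by concatenation. The weak fundamental group $\pi_1^w(A,x)$ is the (edge-path) fundamental group at $x$ of the Vietoris complex $VA$, the simplicial complex with vertex set $X_A$ whose simplices are the local frames. The map $p$ sends the class of a loop $l=[\lambda]$, with $\lambda$ stabilizing in both directions, to the class of the edge loop given by the sequence of vertices $(X_\lambda(n))_{n\in\mathbb Z}$ (which is constantly $x$ for $|n|$ large).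
   Formalization: In ''infimum'', φ_s is taken as the set of α such that s lies in one connected component of 𝒢_α, not merely s ⊂ X_α; with the latter the claim fails (two connected local groupoids on {v,w} above a discrete one: π_1^w is trivial, π_1 is not). *)

(* Defs.v *)
From Stdlib Require Export ZArith List Lia Ensembles Finite_sets Relations.
From Stdlib Require Import Finite_sets_facts.
From Stdlib Require Import ProofIrrelevance PropExtensionality FunctionalExtensionality.

Set Implicit Arguments.
Unset Strict Implicit.
Unset Printing Implicit Defensive.

Open Scope Z_scope.

(* The quotient of T by the equivalence relation generated by R; its elements
   are the equivalence classes themselves, as subsets of T. *)
Definition quot (T : Type) (R : relation T) : Type :=
  {C : T -> Prop | exists a, C = clos_refl_sym_trans T R a}.

Definition cls (T : Type) (R : relation T) (a : T) : quot R :=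
  exist _ (clos_refl_sym_trans T R a) (ex_intro _ a eq_refl).

Lemma cls_eq (T : Type) (R : relation T) (a b : T) :
  clos_refl_sym_trans T R a b -> cls R a = cls R b.
Proof.
intros Hab. apply subset_eq_compat. extensionality c.
apply propositional_extensionality; split; intros H.
- eapply rst_trans; [apply rst_sym; exact Hab | exact H].
- eapply rst_trans; [exact Hab | exact H].
Qed.

Lemma cls_inj (T : Type) (R : relation T) (a b : T) :
  cls R a = cls R b -> clos_refl_sym_trans T R a b.
Proof.
intros H. apply (f_equal (@proj1_sig _ _)) in H; simpl in H.
rewrite H. apply rst_refl.
Qed.

Lemma cls_surj (T : Type) (R : relation T) (c : quot R) : exists a, c = cls R a.
Proof. destruct c as [C [a ->]]. exists a. apply subset_eq_compat. reflexivity. Qed.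

Lemma rst_map (T U : Type) (R : relation T) (S : relation U) (f : T -> U) :
  (forall a a', R a a' -> clos_refl_sym_trans U S (f a) (f a')) ->
  forall a a', clos_refl_sym_trans T R a a' -> clos_refl_sym_trans U S (f a) (f a').
Proof.
intros Hf a a' H; induction H as [| |? ? _ IH|? ? ? _ IH1 _ IH2].
- auto.
- apply rst_refl.
- apply rst_sym; exact IH.
- eapply rst_trans; [exact IH1 | exact IH2].
Qed.

Lemma quot_map_subproof (T U : Type) (R : relation T) (S : relation U) (f : T -> U)
    (fP : forall a a', R a a' -> clos_refl_sym_trans U S (f a) (f a')) (c : quot R) :
  exists v, (fun w => exists a, proj1_sig c a /\ clos_refl_sym_trans U S (f a) w)
            = clos_refl_sym_trans U S v.
Proof.
destruct (cls_surj c) as [a ->]; simpl.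
exists (f a). extensionality w. apply propositional_extensionality; split.
- intros (a' & Ha & H). eapply rst_trans; [|exact H]. exact (rst_map fP Ha).
- intros H. exists a; repeat split; eauto using clos_refl_sym_trans.
Qed.

Definition quot_map (T U : Type) (R : relation T) (S : relation U) (f : T -> U)
    (fP : forall a a', R a a' -> clos_refl_sym_trans U S (f a) (f a'))
    (c : quot R) : quot S :=
  exist _ _ (quot_map_subproof fP c).

Lemma quot_mapE (T U : Type) (R : relation T) (S : relation U) (f : T -> U)
    (fP : forall a a', R a a' -> clos_refl_sym_trans U S (f a) (f a')) (a : T) :
  quot_map fP (cls R a) = cls S (f a).
Proof.
apply subset_eq_compat. extensionality w.
apply propositional_extensionality; split; simpl.
- intros (a' & Ha & H). eapply rst_trans; [exact (rst_map fP Ha) | exact H].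
- intros H. exists a; repeat split; eauto using clos_refl_sym_trans.
Qed.

Lemma quot_map2_subproof (T U : Type) (R : relation T) (S : relation U)
    (f : T -> T -> U)
    (fl : forall b a a', R a a' -> clos_refl_sym_trans U S (f a b) (f a' b))
    (fr : forall a b b', R b b' -> clos_refl_sym_trans U S (f a b) (f a b'))
    (c d : quot R) :
  exists v, (fun w => exists a b, proj1_sig c a /\ proj1_sig d b /\
                      clos_refl_sym_trans U S (f a b) w) = clos_refl_sym_trans U S v.
Proof.
destruct (cls_surj c) as [a ->], (cls_surj d) as [b ->]; simpl.
exists (f a b). extensionality w. apply propositional_extensionality; split.
- intros (a' & b' & Ha & Hb & H). eapply rst_trans; [|exact H].
  eapply rst_trans; [exact (rst_map (fl b) Ha) | exact (rst_map (fr a') Hb)].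
- intros H. exists a, b; repeat split; eauto using clos_refl_sym_trans.
Qed.

Definition quot_map2 (T U : Type) (R : relation T) (S : relation U)
    (f : T -> T -> U)
    (fl : forall b a a', R a a' -> clos_refl_sym_trans U S (f a b) (f a' b))
    (fr : forall a b b', R b b' -> clos_refl_sym_trans U S (f a b) (f a b'))
    (c d : quot R) : quot S :=
  exist _ _ (quot_map2_subproof fl fr c d).

Lemma quot_map2E (T U : Type) (R : relation T) (S : relation U)
    (f : T -> T -> U)
    (fl : forall b a a', R a a' -> clos_refl_sym_trans U S (f a b) (f a' b))
    (fr : forall a b b', R b b' -> clos_refl_sym_trans U S (f a b) (f a b'))
    (a b : T) :
  quot_map2 fl fr (cls R a) (cls R b) = cls S (f a b).
Proof.
apply subset_eq_compat. extensionality w.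
apply propositional_extensionality; split; simpl.
- intros (a' & b' & Ha & Hb & H). eapply rst_trans; [|exact H].
  eapply rst_trans; [exact (rst_map (fl b) Ha) | exact (rst_map (fr a') Hb)].
- intros H. exists a, b; repeat split; eauto using clos_refl_sym_trans.
Qed.

Record group_on (T : Type) := GroupOn {
  gmul : T -> T -> T;
  gone : T;
  ginv : T -> T;
  gmulA : forall a b c, gmul a (gmul b c) = gmul (gmul a b) c;
  gmul1l : forall a, gmul gone a = a;
  gmulVl : forall a, gmul (ginv a) a = gone
}.

Definition group_isomorphism (T U : Type) (G : group_on T) (G' : group_on U)
    (p : T -> U) : Prop :=
  (forall a b, p (gmul G a b) = gmul G' (p a) (p b)) /\
  (forall a b, p a = p b -> a = b) /\
  (forall c, exists a, p a = c).

(* A groupoid whose object set is the subset [obj] of X. The homs are indexed by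
   all pairs of points of X, but are empty unless both points are objects.
   Composition is in diagrammatic order. *)
Record groupoid (X : Type) := Groupoid {
  obj : X -> Prop;
  hom : X -> X -> Type;
  hom_src : forall x y, hom x y -> obj x;
  hom_tgt : forall x y, hom x y -> obj y;
  idm : forall x, obj x -> hom x x;
  comp : forall x y z, hom x y -> hom y z -> hom x z;
  hinv : forall x y, hom x y -> hom y x;
  comp_idl : forall x y (hx : obj x) (f : hom x y), comp (idm hx) f = f;
  comp_idr : forall x y (hy : obj y) (f : hom x y), comp f (idm hy) = f;
  compA : forall x y z t (f : hom x y) (g : hom y z) (h : hom z t),
    comp f (comp g h) = comp (comp f g) h;
  comp_invl : forall x y (hy : obj y) (f : hom x y), comp (hinv f) f = idm hy;
  comp_invr : forall x y (hx : obj x) (f : hom x y), comp f (hinv f) = idm hx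
}.

Arguments obj {X} _ _.
Arguments hom {X} _ _ _.
Arguments idm {X} _ {x} _.
Arguments comp {X _ x y z} _ _.
Arguments hinv {X _ x y} _.

(* All vertex groups are trivial; no connectedness is required. *)
Definition simply_connected (X : Type) (G : groupoid X) : Prop :=
  forall x (hx : obj G x) (f : hom G x x), f = idm G hx.

Definition component (X : Type) (G : groupoid X) (c : X) : Ensemble X :=
  fun z => inhabited (hom G c z).

Definition union_of_components (X : Type) (G : groupoid X) (P : Ensemble X) : Prop :=
  (forall x, P x -> obj G x) /\
  (forall x, P x -> Included X (component G x) P).

(* [tr] gives the structural functors; they are the identity on objects, and are
   defined on the arrows of G_a with both ends in G_b. *)
Record atlas := Atlas {
  pt :> Type;
  idx : Type;
  le : idx -> idx -> Prop;
  le_refl : forall a, le a a;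
  gpd : idx -> groupoid pt;
  overlap : forall a b, le a b ->
    union_of_components (gpd a) (fun x => obj (gpd a) x /\ obj (gpd b) x);
  tr : forall a b, le a b -> forall x y, obj (gpd b) x -> obj (gpd b) y ->
    hom (gpd a) x y -> hom (gpd b) x y;
  tr_idm : forall a b (h : le a b) x (hx : obj (gpd b) x) (hx' : obj (gpd a) x),
    tr h hx hx (idm (gpd a) hx') = idm (gpd b) hx;
  tr_comp : forall a b (h : le a b) x y z
      (hx : obj (gpd b) x) (hy : obj (gpd b) y) (hz : obj (gpd b) z)
      (f : hom (gpd a) x y) (g : hom (gpd a) y z),
    tr h hx hz (comp f g) = comp (tr h hx hy f) (tr h hy hz g);
  tr_refl : forall a (h : le a a) x y (hx : obj (gpd a) x) (hy : obj (gpd a) y)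
      (f : hom (gpd a) x y),
    tr h hx hy f = f;
  tr_trans : forall a b c (hab : le a b) (hbc : le b c) (hac : le a c) x y
      (hbx : obj (gpd b) x) (hby : obj (gpd b) y)
      (hcx : obj (gpd c) x) (hcy : obj (gpd c) y) (f : hom (gpd a) x y),
    tr hbc hcx hcy (tr hab hbx hby f) = tr hac hcx hcy f;
  covered : forall x, exists a, obj (gpd a) x
}.

Arguments le {a} _ _ : rename.
Arguments gpd {a} _ : rename.
Arguments tr {a a0 b} h {x y} hx hy f : rename.

Definition local_frame_at (A : atlas) (a : idx A) (s : Ensemble A) : Prop :=
  Inhabited A s /\ Finite A s /\
  exists c, obj (gpd a) c /\ Included A s (component (gpd a) c).

Definition local_frame (A : atlas) (s : Ensemble A) : Prop :=
  exists a, local_frame_at a s.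

Definition initial_in (A : atlas) (P : idx A -> Prop) (a : idx A) : Prop :=
  P a /\ forall b, P b -> le a b.

(* The index a belongs to phi_s when s is a local frame of G_a, that is, when s
   lies in one connected component of G_a; s being a set of objects of G_a is not
   enough. The two conditions agree if s is a singleton, or if G_a is connected.
   With the weaker condition, two connected local groupoids on {v, w} lying above
   a discrete one would form an infimum atlas with pi_1^w trivial but pi_1 not. *)
Definition infimum (A : atlas) : Prop :=
  forall s : Ensemble A, local_frame s -> exists a, initial_in (fun a => local_frame_at a s) a.

Definition good (A : atlas) : Prop :=
  forall x : A, exists a, initial_in (fun a => obj (gpd a) x) a.

(* An arrow of some local groupoid. An equality of local arrows includes the
   equality of the local groupoids they live in, and of their ends. *)
Record local_arrow (A : atlas) := LocalArrow {
  la_idx : idx A;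
  la_src : A;
  la_tgt : A;
  la_arr : hom (gpd la_idx) la_src la_tgt
}.

Arguments LocalArrow {A la_idx la_src la_tgt} la_arr.

Definition id_arrow (A : atlas) (a : idx A) (x : A) (hx : obj (gpd a) x) : local_arrow A :=
  LocalArrow (idm (gpd a) hx).

Record morphism (A B : atlas) := Morphism {
  pt_map :> A -> B;
  idx_map : idx A -> idx B;
  idx_mono : forall a b, le a b -> le (idx_map a) (idx_map b);
  obj_map : forall a x, obj (gpd a) x -> obj (gpd (idx_map a)) (pt_map x);
  arr_map : forall a x y, hom (gpd a) x y ->
    hom (gpd (idx_map a)) (pt_map x) (pt_map y);
  arr_map_idm : forall a x (hx : obj (gpd a) x)
      (hx' : obj (gpd (idx_map a)) (pt_map x)),
    arr_map (idm (gpd a) hx) = idm (gpd (idx_map a)) hx';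
  arr_map_comp : forall a x y z (f : hom (gpd a) x y) (g : hom (gpd a) y z),
    arr_map (comp f g) = comp (arr_map f) (arr_map g);
  arr_map_tr : forall a b (h : le a b) x y
      (hx : obj (gpd b) x) (hy : obj (gpd b) y) (f : hom (gpd a) x y),
    arr_map (tr h hx hy f) =
    tr (idx_mono h) (obj_map hx) (obj_map hy) (arr_map f)
}.

Arguments arr_map {A B} m {a x y} _ : rename.
Arguments idx_map {A B} m _ : rename.
Arguments idx_mono {A B} m {a b} _ : rename.
Arguments obj_map {A B} m {a x} _ : rename.

Definition push (A B : atlas) (f : morphism A B) (u : local_arrow A) : local_arrow B :=
  LocalArrow (arr_map f (la_arr u)).

Program Definition mcomp (A B C : atlas) (g : morphism B C) (f : morphism A B) :
    morphism A C :=
  {| pt_map := fun x => g (f x);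
     idx_map := fun a => idx_map g (idx_map f a);
     arr_map := fun a x y h => arr_map g (arr_map f h) |}.
Next Obligation. now apply idx_mono, idx_mono. Defined.
Next Obligation. now apply obj_map, obj_map. Defined.
Next Obligation.
rewrite (arr_map_idm hx (obj_map f hx)). apply arr_map_idm.
Qed.
Next Obligation. now rewrite !arr_map_comp. Qed.
Next Obligation. now rewrite !arr_map_tr. Qed.

(* f <| f' : the equality of functors is stated arrow by arrow; taken at
   identities, it contains the equality of the maps on objects. *)
Definition tri (A B : atlas) (f f' : morphism A B) : Prop :=
  forall a, exists h : le (idx_map f a) (idx_map f' a),
  forall x y (g : hom (gpd a) x y),
  exists (hx : obj (gpd (idx_map f' a)) (f x)) (hy : obj (gpd (idx_map f' a)) (f y)),
    LocalArrow (tr h hx hy (arr_map f g)) = LocalArrow (arr_map f' g).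

Program Definition prod_groupoid (X Y : Type) (G : groupoid X) (H : groupoid Y) :
    groupoid (X * Y) :=
  {| obj := fun z => obj G (fst z) /\ obj H (snd z);
     hom := fun z t => (hom G (fst z) (fst t) * hom H (snd z) (snd t))%type;
     idm := fun z hz => (idm G (proj1 hz), idm H (proj2 hz));
     comp := fun x y z f g => (comp (fst f) (fst g), comp (snd f) (snd g));
     hinv := fun x y f => (hinv (fst f), hinv (snd f)) |}.
Next Obligation. split; eapply hom_src; eassumption. Qed.
Next Obligation. split; eapply hom_tgt; eassumption. Qed.
Next Obligation. now rewrite !comp_idl. Qed.
Next Obligation. now rewrite !comp_idr. Qed.
Next Obligation. now rewrite !compA. Qed.
Next Obligation. f_equal; apply comp_invl. Qed.
Next Obligation. f_equal; apply comp_invr. Qed.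

Program Definition prod_atlas (A B : atlas) : atlas :=
  {| pt := A * B;
     idx := idx A * idx B;
     le := fun a b => le (fst a) (fst b) /\ le (snd a) (snd b);
     gpd := fun a => prod_groupoid (gpd (fst a)) (gpd (snd a));
     tr := fun a b h x y hx hy f =>
       (tr (proj1 h) (proj1 hx) (proj1 hy) (fst f),
        tr (proj2 h) (proj2 hx) (proj2 hy) (snd f)) |}.
Next Obligation. split; apply le_refl. Qed.
Next Obligation.
simpl in *. split; [now intros x [Hx _]|].
intros [x y] [[Hx Hy] [Hx' Hy']] [z t] [[f g]]; simpl in *.
destruct (proj2 (overlap H) x (conj Hx Hx') z (inhabits f)).
destruct (proj2 (overlap H0) y (conj Hy Hy') t (inhabits g)).
unfold Ensembles.In; simpl; auto.
Qed.
Next Obligation. f_equal; apply tr_idm. Qed.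
Next Obligation. f_equal; apply tr_comp. Qed.
Next Obligation. f_equal; apply tr_refl. Qed.
Next Obligation. f_equal; apply tr_trans. Qed.
Next Obligation.
destruct (covered p) as [a Ha], (covered p0) as [b Hb]. exists (a, b); simpl; auto.
Qed.

(* The arrows x -> y are the proofs that x and y both lie in P: there is exactly
   one of them, by proof irrelevance. *)
Program Definition chaotic (X : Type) (P : X -> Prop) : groupoid X :=
  {| obj := P;
     hom := fun x y => P x /\ P y;
     idm := fun x hx => conj hx hx;
     comp := fun x y z f g => conj (proj1 f) (proj2 g);
     hinv := fun x y f => conj (proj2 f) (proj1 f) |}.
Solve Obligations with (intros; solve [tauto | apply proof_irrelevance]).

(* [Vertex n] stands for the subset {n} of Z, and [Edge n] for {n, n + 1}. *)
Inductive cell := Vertex (n : Z) | Edge (n : Z).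

Definition in_cell (s : cell) (k : Z) : Prop :=
  match s with Vertex n => k = n | Edge n => k = n \/ k = n + 1 end.

Program Definition line : atlas :=
  {| pt := Z;
     idx := cell;
     le := fun s t => forall k, in_cell s k -> in_cell t k;
     gpd := fun s => chaotic (in_cell s);
     tr := fun s t h x y hx hy f => conj hx hy |}.
Next Obligation.
split; [now intros x [Hx _]|].
intros x [Hx Hx'] z [[_ Hz]]; simpl in *; unfold Ensembles.In; auto.
Qed.
Next Obligation. apply proof_irrelevance. Qed.
Next Obligation. apply proof_irrelevance. Qed.
Next Obligation. now exists (Vertex x). Qed.

Definition line_arrow (n : Z) : local_arrow line :=
  @LocalArrow line (Edge n) n (n + 1) (conj (or_introl eq_refl) (or_intror eq_refl)).

Lemma telescope (X : Type) (G : groupoid X) o x y z (f : hom G o x) (g g' : hom G o y)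
    (h : hom G o z) :
  g = g' -> comp (hinv f) h = comp (comp (hinv f) g) (comp (hinv g') h).
Proof.
intros <-. rewrite <- compA, (compA g), (comp_invr (hom_src g)), comp_idl. reflexivity.
Qed.

Lemma hinv_idm (X : Type) (G : groupoid X) x (hx : obj G x) : hinv (idm G hx) = idm G hx.
Proof. rewrite <- (comp_idr hx (hinv _)). apply comp_invl. Qed.

(* A chain of local arrows, with a local groupoid at each vertex, is a morphism
   from the line. *)
Section LineMorphism.
Variables (A : atlas) (e : Z -> local_arrow A) (a : Z -> idx A).
Hypothesis e_chain : forall n, la_tgt (e n) = la_src (e (n + 1)).
Hypothesis a_obj : forall n, obj (gpd (a n)) (la_src (e n)).
Hypothesis a_le : forall n, le (a n) (la_idx (e n)) /\ le (a (n + 1)) (la_idx (e n)).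

Let chain_pt (n : Z) : A := la_src (e n).
Let chain_idx (s : cell) : idx A :=
  match s with Vertex n => a n | Edge n => la_idx (e n) end.
Let base (s : cell) : Z := match s with Vertex n | Edge n => n end.

Definition chain_leg (s : cell) (k : Z) :
  in_cell s k -> hom (gpd (chain_idx s)) (chain_pt (base s)) (chain_pt k).
Proof.
destruct s as [n|n]; simpl; intros Hk.
- exact (eq_rect n (fun k => hom (gpd (a n)) (chain_pt n) (chain_pt k))
    (idm _ (a_obj n)) k (eq_sym Hk)).
- destruct (Z.eq_dec n k) as [E|Hnk].
  + exact (eq_rect n (fun k => hom (gpd (la_idx (e n))) (chain_pt n) (chain_pt k))
      (idm _ (hom_src (la_arr (e n)))) k E).
  + assert (E : n + 1 = k).
    { destruct Hk as [->|Hk]; [now destruct Hnk|now symmetry]. }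
    exact (eq_rect (n + 1) (fun k => hom (gpd (la_idx (e n))) (chain_pt n) (chain_pt k))
      (eq_rect _ (hom (gpd (la_idx (e n))) (la_src (e n))) (la_arr (e n)) _ (e_chain n)) k E).
Defined.

Lemma chain_leg_id s k (H H' : in_cell s k) (h : obj (gpd (chain_idx s)) (chain_pt k)) :
  comp (hinv (chain_leg H)) (chain_leg H') = idm _ h.
Proof. rewrite (proof_irrelevance _ H' H). apply comp_invl. Qed.

Lemma chain_mono s t : le (a := line) s t -> le (chain_idx s) (chain_idx t).
Proof.
revert s t; intros [n|n] [m|m] H; simpl in *.
- destruct (H n eq_refl). apply le_refl.
- destruct (H n eq_refl) as [->| ->]; apply a_le.
- pose proof (H n (or_introl eq_refl)). pose proof (H (n + 1) (or_intror eq_refl)). lia.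
- pose proof (H n (or_introl eq_refl)). pose proof (H (n + 1) (or_intror eq_refl)).
    replace m with n by lia. apply le_refl.
Qed.

Definition chain_morphism : morphism line A.
Proof.
unshelve refine (@Morphism line A chain_pt chain_idx _ _
  (fun s x y h => comp (hinv (chain_leg (proj1 h))) (chain_leg (proj2 h))) _ _ _).
- exact chain_mono.
- intros s x Hx. exact (hom_tgt (chain_leg Hx)).
- intros s x Hx Hx'. apply chain_leg_id.
- intros s x y z f g. rewrite (proof_irrelevance _ (proj1 (comp f g)) (proj1 f)), (proof_irrelevance _ (proj2 (comp f g)) (proj2 g)).
  apply telescope. f_equal; apply proof_irrelevance.
- intros s t H x y Hx Hy f.
  destruct s as [n|n].
  + assert (Ex := proj1 f). assert (Ey := proj2 f). simpl in Ex, Ey. subst x y.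
    rewrite (@chain_leg_id (Vertex n) n _ _ (a_obj n)).
    rewrite (chain_leg_id _ _ (hom_tgt (chain_leg Hx))).
    rewrite (proof_irrelevance _ Hy Hx), tr_idm. apply f_equal, proof_irrelevance.
  + assert (E : t = Edge n).
    { destruct t as [m|m]; pose proof (H n (or_introl eq_refl)) as H1;
        pose proof (H (n + 1) (or_intror eq_refl)) as H2; simpl in H1, H2;
        first [exfalso; lia | f_equal; lia]. }
    subst t. etransitivity; [|symmetry; apply tr_refl].
    exact (f_equal (fun h : in_cell (Edge n) x /\ in_cell (Edge n) y =>
      comp (hinv (@chain_leg (Edge n) x (proj1 h))) (@chain_leg (Edge n) y (proj2 h)))
      (proof_irrelevance _ _ _)).
Defined.

Lemma push_chain_morphism n : push chain_morphism (line_arrow n) = e n.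
Proof.
unfold push, line_arrow; cbn [la_idx la_src la_tgt la_arr chain_morphism arr_map proj1 proj2].
unfold chain_leg. cbn [base].
destruct (Z.eq_dec n n) as [E|]; [|lia].
destruct (Z.eq_dec n (n + 1)) as [|E']; [lia|].
rewrite (proof_irrelevance _ E eq_refl). cbn [eq_rect].
set (f := eq_rect _ _ _ _ (e_chain n)).
rewrite hinv_idm, comp_idl.
match goal with |- context [eq_rect (n + 1) _ f _ ?E1] =>
  rewrite (proof_irrelevance _ E1 eq_refl) end. cbn [eq_rect].
transitivity (LocalArrow f); [reflexivity|].
unfold f. destruct (e_chain n). cbn [eq_rect]. now destruct (e n).
Qed.
End LineMorphism.

Program Definition slice (N : Z) : morphism line (prod_atlas line line) :=
  {| pt_map := fun n => (n, N);
     idx_map := fun s => (s, Vertex N);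
     arr_map := fun s x y f => (f, idm (gpd (a := line) (Vertex N)) eq_refl) |}.
Next Obligation. f_equal; apply proof_irrelevance. Qed.
Next Obligation. f_equal; apply proof_irrelevance. Qed.
Next Obligation. f_equal; apply proof_irrelevance. Qed.

Section Strong.
Variable A : atlas.
Implicit Types (l m k : morphism line A).

Definition nth_arrow l (n : Z) : local_arrow A := push l (line_arrow n).

Definition stabilizes_left l (x : A) : Prop :=
  exists (a : idx A) (hx : obj (gpd a) x) (N : Z),
  forall n, n < N -> nth_arrow l n = id_arrow hx.

Definition stabilizes_right l (x : A) : Prop :=
  exists (a : idx A) (hx : obj (gpd a) x) (N : Z),
  forall n, N < n -> nth_arrow l n = id_arrow hx.

(* The class of a stabilizing l may also contain morphisms which do not stabilize. *)
Definition path (x0 x1 : A) : Type :=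
  {c : quot (@tri line A) |
    exists l, stabilizes_left l x0 /\ stabilizes_right l x1 /\ c = cls (@tri line A) l}.

Definition path_of l x0 x1 (hl : stabilizes_left l x0) (hr : stabilizes_right l x1) :
    path x0 x1 :=
  exist _ (cls (@tri line A) l) (ex_intro _ l (conj hl (conj hr eq_refl))).

Definition homotopic (x0 x1 : A) (c c' : path x0 x1) : Prop :=
  exists (H : morphism (prod_atlas line line) A) (N0 N1 M0 M1 : Z)
    (a0 a1 : idx A) (h0 : obj (gpd a0) x0) (h1 : obj (gpd a1) x1),
    cls (@tri line A) (mcomp H (slice N0)) = proj1_sig c /\
    cls (@tri line A) (mcomp H (slice N1)) = proj1_sig c' /\
    forall u : local_arrow (prod_atlas line line),
      (fst (la_src u) < M0 -> push H u = id_arrow h0) /\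
      (M1 < fst (la_tgt u) -> push H u = id_arrow h1).

Definition pi1 (x : A) : Type := quot (@homotopic x x).

Definition loop_class l x (hl : stabilizes_left l x) (hr : stabilizes_right l x) : pi1 x :=
  cls (@homotopic x x) (path_of hl hr).

(* k follows l as long as it moves, and then follows m, translated. Only the
   arrows of k on the edges are prescribed: in a good atlas, they determine the
   class of k. *)
Definition concatenates l m k : Prop :=
  exists (x : A) (a b : idx A) (ha : obj (gpd a) x) (hb : obj (gpd b) x) (N M : Z),
    (forall n, N <= n -> nth_arrow l n = id_arrow ha) /\
    (forall n, n < M -> nth_arrow m n = id_arrow hb) /\
    (forall n, n < N -> nth_arrow k n = nth_arrow l n) /\
    (forall n, N <= n -> nth_arrow k n = nth_arrow m (n - N + M)).

Definition induced_by_concatenation (x : A) (G : group_on (pi1 x)) : Prop :=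
  forall l m k (hll : stabilizes_left l x) (hlr : stabilizes_right l x)
    (hml : stabilizes_left m x) (hmr : stabilizes_right m x)
    (hkl : stabilizes_left k x) (hkr : stabilizes_right k x),
  concatenates l m k ->
  gmul G (loop_class hll hlr) (loop_class hml hmr) = loop_class hkl hkr.

End Strong.

Record complex := Complex {
  vert :> Type;
  simplex : Ensemble vert -> Prop;
  simplex_inhabited : forall s, simplex s -> Inhabited vert s;
  simplex_finite : forall s, simplex s -> Finite vert s;
  simplex_singleton : forall v, simplex (Singleton vert v);
  simplex_face : forall s t, simplex s -> Included vert t s -> Inhabited vert t ->
    simplex t
}.

Program Definition vietoris (A : atlas) : complex :=
  {| vert := A; simplex := @local_frame A |}.
Next Obligation. now destruct H as [a [H _]]. Qed.
Next Obligation. now destruct H as [a [_ [H _]]]. Qed.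
Next Obligation.
destruct (covered v) as [a Ha]. exists a. repeat split.
- exists v. constructor.
- apply Singleton_is_finite.
- exists v. split; [exact Ha|]. intros z Hz; destruct Hz.
  exact (inhabits (idm (gpd a) Ha)).
Qed.
Next Obligation.
destruct H as [a (_ & Hf & c & Hc & Hs)]. exists a. repeat split.
- exact H1.
- exact (Finite_downward_closed _ s Hf t H0).
- exists c. split; [exact Hc|]. intros z Hz. exact (Hs z (H0 z Hz)).
Qed.

(* The list l enumerates the vertices of the walk after the initial vertex u. *)
Fixpoint edge_walk (K : complex) (u : K) (l : list K) (w : K) : Prop :=
  match l with
  | nil => u = w
  | cons v l' => simplex (Couple K u v) /\ edge_walk v l' w
  end.

Definition edge_loop (K : complex) (x : K) : Type := {l : list K | edge_walk x l x}.

Inductive contraction (K : complex) : list K -> list K -> Prop :=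
| contract_triangle p u v w q : simplex (Triple K u v w) ->
    contraction (p ++ u :: v :: w :: q) (p ++ u :: w :: q)
| contract_repeat p u q :
    contraction (p ++ u :: u :: q) (p ++ u :: q).

Definition edge_step (K : complex) (x : K) (l l' : edge_loop x) : Prop :=
  contraction (x :: proj1_sig l) (x :: proj1_sig l').

Definition edge_pi1 (K : complex) (x : K) : Type := quot (@edge_step K x).

Section EdgePathGroup.
Variable K : complex.
Implicit Types (u v w x : K) (l m p q s : list K).

Lemma simplex_couple u v (S : Ensemble K) :
  simplex S -> Ensembles.In K S u -> Ensembles.In K S v -> simplex (Couple K u v).
Proof.
intros HS Hu Hv. apply simplex_face with S; [exact HS| |exists u; constructor].
intros z Hz; destruct Hz; assumption.
Qed.

Lemma edge_walk_cat u l v m w :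
  edge_walk u l v -> edge_walk v m w -> edge_walk u (l ++ m) w.
Proof.
revert u; induction l as [|a l IH]; simpl; intros u.
- now intros ->.
- intros [H1 H2] H3; auto.
Qed.

Lemma edge_walk_split u l a q w :
  edge_walk u (l ++ a :: q) w -> edge_walk u (l ++ a :: nil) a /\ edge_walk a q w.
Proof.
revert u; induction l as [|b l IH]; simpl; intros u.
- tauto.
- intros [H1 H2]. destruct (IH _ H2). tauto.
Qed.

Lemma edge_walk_last u l w : edge_walk u l w -> exists p, u :: l = p ++ w :: nil.
Proof.
revert u; induction l as [|a l IH]; simpl; intros u.
- intros ->. now exists nil.
- intros [_ H]. destruct (IH _ H) as [p ->]. now exists (u :: p).
Qed.

Lemma edge_walk_rev u l w :
  edge_walk u l w -> exists l', rev (u :: l) = w :: l' /\ edge_walk w l' u.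
Proof.
revert u; induction l as [|a l IH]; intros u.
- simpl. intros ->. now exists nil.
- intros [H1 H2]. destruct (IH _ H2) as [l' [E H3]].
  exists (l' ++ u :: nil). split.
  + change (rev (u :: a :: l)) with (rev (a :: l) ++ u :: nil). now rewrite E.
  + apply edge_walk_cat with a; [exact H3|]. simpl. split; [|reflexivity].
    apply simplex_couple with (Couple K u a); [exact H1|right|left].
Qed.

Lemma contraction_cat p q s s' : contraction s s' -> contraction (p ++ s ++ q) (p ++ s' ++ q).
Proof.
intros H; destruct H as [p' u v w q' H|p' u q']; rewrite <- !app_assoc, !app_assoc;
  rewrite <- !(app_assoc (p ++ p')); simpl.
- now apply contract_triangle.
- apply contract_repeat.
Qed.

Lemma contraction_rev s s' : contraction s s' -> contraction (rev s) (rev s').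
Proof.
intros H; destruct H as [p u v w q H|p u q];
  repeat (rewrite rev_app_distr || rewrite <- app_assoc || simpl).
- apply contract_triangle. apply simplex_face with (Triple K u v w); [exact H| |].
  + intros z Hz; destruct Hz; constructor.
  + exists u; constructor.
- apply contract_repeat.
Qed.

Lemma contraction_walk s s' u l : contraction s s' -> s = u :: l ->
  exists l', s' = u :: l' /\ forall w, edge_walk u l w -> edge_walk u l' w.
Proof.
intros H; destruct H as [[|b p] a v w q H|[|b p] a q]; simpl; intros E;
  injection E as <- <-; eexists; (split; [reflexivity|]); intros z Hz.
- destruct Hz as (_ & _ & Hz). split; [|exact Hz].
  apply simplex_couple with (Triple K a v w); [exact H|constructor|constructor].
- apply edge_walk_split in Hz; destruct Hz as (H1 & _ & _ & H3).
  change (a :: w :: q) with ((a :: nil) ++ w :: q). rewrite app_assoc.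
  apply edge_walk_cat with a; [exact H1|]. split; [|exact H3].
  apply simplex_couple with (Triple K a v w); [exact H|constructor|constructor].
- exact (proj2 Hz).
- apply edge_walk_split in Hz; destruct Hz as (H1 & _ & H3).
  change (a :: q) with ((a :: nil) ++ q). rewrite app_assoc.
  now apply edge_walk_cat with a.
Qed.

Lemma contractions_step x (a b : edge_loop x) :
  clos_refl_trans_1n _ (@contraction K) (x :: proj1_sig a) (x :: proj1_sig b) ->
  clos_refl_sym_trans _ (@edge_step K x) a b.
Proof.
destruct a as [l Hl], b as [m Hm]; simpl.
remember (x :: l) as s eqn:Es; remember (x :: m) as t eqn:Et; intros H.
revert l Hl Es; induction H as [s|s s' t H1 H2 IH]; intros l Hl Es; subst.
- injection Es as ->. rewrite (proof_irrelevance _ Hl Hm). apply rst_refl.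
- destruct (contraction_walk H1 eq_refl) as [l' [-> Hl']].
  apply rst_trans with (exist _ l' (Hl' _ Hl)); [|now apply IH].
  now apply rst_step.
Qed.

Variable x : K.

Definition edge_loop_cat (a b : edge_loop x) : edge_loop x :=
  exist _ (proj1_sig a ++ proj1_sig b) (edge_walk_cat (proj2_sig a) (proj2_sig b)).

Definition edge_loop_nil : edge_loop x := exist _ nil eq_refl.

Lemma edge_loop_rev_subproof (a : edge_loop x) : edge_walk x (tl (rev (x :: proj1_sig a))) x.
Proof. destruct (edge_walk_rev (proj2_sig a)) as [l [-> H]]. exact H. Qed.

Definition edge_loop_rev (a : edge_loop x) : edge_loop x :=
  exist _ (tl (rev (x :: proj1_sig a))) (edge_loop_rev_subproof a).

Lemma edge_loop_revE (a : edge_loop x) : x :: proj1_sig (edge_loop_rev a) = rev (x :: proj1_sig a).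
Proof.
unfold edge_loop_rev, proj1_sig at 1.
destruct (edge_walk_rev (proj2_sig a)) as [l [-> H]]. reflexivity.
Qed.

Lemma edge_step_catl (b a a' : edge_loop x) : edge_step a a' ->
  clos_refl_sym_trans _ (@edge_step K x) (edge_loop_cat a b) (edge_loop_cat a' b).
Proof. intros H. apply rst_step. exact (contraction_cat nil (proj1_sig b) H). Qed.

Lemma edge_step_catr (a b b' : edge_loop x) : edge_step b b' ->
  clos_refl_sym_trans _ (@edge_step K x) (edge_loop_cat a b) (edge_loop_cat a b').
Proof.
intros H. apply rst_step. unfold edge_step, edge_loop_cat; simpl.
destruct (edge_walk_last (proj2_sig a)) as [p Hp].
rewrite !app_comm_cons, Hp, <- !app_assoc; simpl.
rewrite <- (app_nil_r (x :: proj1_sig b)), <- (app_nil_r (x :: proj1_sig b')).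
now apply contraction_cat.
Qed.

Lemma edge_step_rev (a a' : edge_loop x) : edge_step a a' ->
  clos_refl_sym_trans _ (@edge_step K x) (edge_loop_rev a) (edge_loop_rev a').
Proof.
intros H. apply rst_step. unfold edge_step. rewrite !edge_loop_revE.
now apply contraction_rev.
Qed.

Lemma edge_walk_retract u l w : edge_walk u l w ->
  clos_refl_trans_1n _ (@contraction K) (rev l ++ u :: l) (w :: nil).
Proof.
revert u; induction l as [|v l IH]; simpl; intros u.
- intros ->. apply rt1n_refl.
- intros [H1 H2]. rewrite <- app_assoc. simpl.
  eapply Relation_Operators.rt1n_trans.
  { apply contract_triangle. apply simplex_face with (Couple K u v); [exact H1| |].
    - intros z Hz; destruct Hz; constructor.
    - exists v; constructor. }
  eapply Relation_Operators.rt1n_trans; [apply contract_repeat|]. now apply IH.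
Qed.

Definition edge_path_group : group_on (edge_pi1 x).
Proof.
refine (@GroupOn _ (quot_map2 edge_step_catl edge_step_catr)
  (cls _ edge_loop_nil) (quot_map edge_step_rev) _ _ _).
- intros a b c. destruct (cls_surj a) as [l ->], (cls_surj b) as [m ->], (cls_surj c) as [k ->].
  rewrite !quot_map2E. f_equal. apply subset_eq_compat. apply app_assoc.
- intros a. destruct (cls_surj a) as [l ->]. rewrite quot_map2E.
  f_equal. destruct l. now apply subset_eq_compat.
- intros a. destruct (cls_surj a) as [l ->]. rewrite quot_mapE, quot_map2E.
  apply cls_eq, contractions_step.
  change (clos_refl_trans_1n _ (@contraction K)
    ((x :: proj1_sig (edge_loop_rev l)) ++ proj1_sig l) (x :: nil)).
  rewrite edge_loop_revE. simpl. rewrite <- app_assoc.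
  exact (edge_walk_retract (proj2_sig l)).
Defined.

End EdgePathGroup.

(* In an infimum atlas, any two loops at the same point can be concatenated. *)
Lemma infimum_good (A : atlas) : infimum A -> good A.
Proof.
intros inf x. destruct (inf (Singleton A x)) as [a [[_ [_ [c [Hc Hx]]]] Ha]].
- exact (simplex_singleton (c := vietoris A) x).
- exists a. split.
  + destruct (Hx x (In_singleton A x)) as [f]. exact (hom_tgt f).
  + intros b Hb. apply Ha. split; [|split].
    * exists x. constructor.
    * apply Singleton_is_finite.
    * exists x. split; [exact Hb|]. intros z Hz; destruct Hz. exact (inhabits (idm _ Hb)).
Qed.

Lemma concatenates_ex (A : atlas) (x : A) (l m : morphism line A) : good A ->
  stabilizes_right l x -> stabilizes_left m x -> exists k, concatenates l m k.
Proof.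
intros gA [a [ha [N HN]]] [b [hb [M HM]]].
destruct (gA x) as [i [hi Hi]].
set (e := fun n => if n <? N + 1 then nth_arrow l n else nth_arrow m (n - (N + 1) + M)).
set (v := fun n => if n <? N + 1 then idx_map l (Vertex n) else
                   if n =? N + 1 then i else idx_map m (Vertex (n - (N + 1) + M))).
assert (El : l (N + 1) = x).
{ exact (f_equal (@la_src A) (HN (N + 1) ltac:(lia))). }
assert (Em : m M = x).
{ replace M with (M - 1 + 1) by lia. exact (f_equal (@la_tgt A) (HM (M - 1) ltac:(lia))). }
assert (Ve : forall k n, n = k \/ n = k + 1 -> le (a := line) (Vertex n) (Edge k)).
{ intros k n H z ->. exact H. }
assert (Hv : forall (f : morphism line A) n, obj (gpd (idx_map f (Vertex n))) (f n)).
{ intros f n. apply (obj_map f (a := Vertex n)). reflexivity. }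
assert (He : forall (f : morphism line A) k n, n = k \/ n = k + 1 ->
  obj (gpd (idx_map f (Edge k))) (f n)).
{ intros f k n H. apply (obj_map f (a := Edge k)). exact H. }
unshelve eset (k := @chain_morphism A e v _ _ _).
- intros n. unfold e.
  destruct (Z.ltb_spec n (N + 1)), (Z.ltb_spec (n + 1) (N + 1)); try lia; try reflexivity; simpl.
  + replace (n + 1) with (N + 1) by lia. replace (N + 1 - (N + 1) + M) with M by lia. congruence.
  + f_equal. lia.
- intros n. unfold e, v.
  destruct (Z.ltb_spec n (N + 1)), (Z.eqb_spec n (N + 1)); try lia; simpl; try apply Hv.
  subst n. replace (N + 1 - (N + 1) + M) with M by lia. now rewrite Em.
- intros n. unfold e, v.
  destruct (Z.ltb_spec n (N + 1)), (Z.ltb_spec (n + 1) (N + 1)),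
    (Z.eqb_spec (n + 1) (N + 1)), (Z.eqb_spec n (N + 1)); try lia; cbn [nth_arrow push la_idx line_arrow];
    split; try (apply idx_mono, Ve; lia); apply Hi.
  + rewrite <- El. apply He. lia.
  + subst n. rewrite <- Em. apply He. lia.
- exists k, x, a, b, ha, hb, (N + 1), M. repeat split.
  + intros n Hn. apply HN. lia.
  + exact HM.
  + intros n Hn. unfold nth_arrow at 1, k. rewrite push_chain_morphism. unfold e.
    now destruct (Z.ltb_spec n (N + 1)); [|lia].
  + intros n Hn. unfold nth_arrow at 1, k. rewrite push_chain_morphism. unfold e.
    now destruct (Z.ltb_spec n (N + 1)); [lia|].
Qed.

Lemma concatenates_left (A : atlas) (x : A) (l m k : morphism line A) :
  concatenates l m k -> stabilizes_left l x -> stabilizes_left k x.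
Proof.
intros (y & a & b & ha & hb & N & M & _ & _ & Hk & _) (c & hc & P & HP).
exists c, hc, (Z.min N P). intros n Hn. rewrite Hk by lia. apply HP. lia.
Qed.

Lemma concatenates_right (A : atlas) (x : A) (l m k : morphism line A) :
  concatenates l m k -> stabilizes_right m x -> stabilizes_right k x.
Proof.
intros (y & a & b & ha & hb & N & M & _ & _ & _ & Hk) (c & hc & P & HP).
exists c, hc, (Z.max N (P + N - M)). intros n Hn. rewrite Hk by lia. apply HP. lia.
Qed.

Definition zrange (N M : Z) : list Z :=
  map (fun i => N + Z.of_nat i) (seq 1 (Z.to_nat (M - N))).

Section Canonical.
Variable A : atlas.
Implicit Types l m k : morphism line A.

Lemma edge_walk_trace l N M : N <= M ->
  @edge_walk (vietoris A) (l N) (map l (zrange N M)) (l M).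
Proof.
intros H. unfold zrange. rewrite map_map.
enough (E : forall d n : nat, @edge_walk (vietoris A) (l (N + Z.of_nat n))
    (map (fun i => l (N + Z.of_nat i)) (seq (S n) d)) (l (N + Z.of_nat (n + d)%nat))).
{ specialize (E (Z.to_nat (M - N)) 0%nat). simpl in E.
  replace (N + Z.of_nat (Z.to_nat (M - N))) with M in E by lia.
  replace (N + 0) with N in E by lia. exact E. }
induction d as [|d IH]; intros n.
- simpl. now rewrite Nat.add_0_r.
- cbn [seq map edge_walk]. split; [|replace (n + S d)%nat with (S n + d)%nat by lia; apply IH].
  set (u := nth_arrow l (N + Z.of_nat n)).
  replace (N + Z.of_nat (S n)) with (N + Z.of_nat n + 1) by lia.
  exists (la_idx u). repeat split.
  + exists (la_src u). constructor.
  + apply Finite_downward_closed with (Add A (Singleton A (la_src u)) (la_tgt u)).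
    * apply Add_preserves_Finite, Singleton_is_finite.
    * intros z Hz; destruct Hz; [left|right]; constructor.
  + exists (la_src u). split; [exact (hom_src (la_arr u))|].
    intros z Hz; destruct Hz.
    * exact (inhabits (idm _ (hom_src (la_arr u)))).
    * exact (inhabits (la_arr u)).
Qed.

Definition trace_loop l (x : A) N M (hNM : N <= M) (hN : l N = x) (hM : l M = x) :
    @edge_loop (vietoris A) x :=
  exist _ (map l (zrange N M))
    (eq_ind (l M) (@edge_walk (vietoris A) x (map l (zrange N M)))
      (eq_ind (l N) (fun y => @edge_walk (vietoris A) y (map l (zrange N M)) (l M))
        (edge_walk_trace l hNM) x hN) x hM).

(* This determines p, as every element of pi1 is some [loop_class hl hr]. *)
Definition canonical_map (x : A) (p : pi1 x -> @edge_pi1 (vietoris A) x) : Prop :=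
  forall l (hl : stabilizes_left l x) (hr : stabilizes_right l x) N M (hNM : N <= M)
    (hN : forall n, n <= N -> l n = x) (hM : forall n, M <= n -> l n = x),
  p (loop_class hl hr) =
  cls _ (trace_loop hNM (hN N (Z.le_refl N)) (hM M (Z.le_refl M))).

End Canonical.

(* Main.v *)
Require Import Defs.
From Stdlib Require Import ClassicalEpsilon Image.
From Stdlib Require Import PropExtensionality FunctionalExtensionality ProofIrrelevance.

Set Implicit Arguments.
Unset Strict Implicit.
Unset Printing Implicit Defensive.

(** Both groups are quotients of the same set of sequences: maps from Z to the
    points of A, eventually equal to x on both sides, whose consecutive values
    span a simplex of the Vietoris complex VA. The theorem holds because the two
    equivalence relations on these sequences coincide.

    On the strong side, a morphism from a line or a plane to A carries more data
    than its values on points, namely the choice of local groupoids and of local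
    arrows. Simple connectedness leaves no choice for the arrows. For the local
    groupoids, the infimum hypothesis provides, for the image of each cell, a
    smallest local groupoid in which that image is a local frame. These smallest
    choices are monotone in the cell, so any map on points which sends every cell
    to a local frame extends to a morphism [realize], and this morphism lies below
    every other extension. Hence the class of a path is determined by its values
    on points ([cls_tri_eq]), and a homotopy is the same thing as a finite pile of
    sequences such that the four values on each unit square span a simplex
    ([traces_homotopic], [traces_homotopic_seq]). The relation [homotopic_seq]
    generated by such pairs of rows is a notion about VA only.

    On the weak side, [homotopic_seq_edge_class] compares this relation with the
    contractions of edge loops, in any simplicial complex. A unit square of a
    homotopy is crossed by two triangle moves, so that adjacent rows spell
    equivalent edge loops. Conversely, a triangle move changes a single value of a
    sequence, up to a repetition; and a repetition can be pushed step by step to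
    the right until it disappears in the constant end of the sequence, each step
    being again a pair of adjacent rows. The same trick makes a sequence homotopic
    to its translates, which is why forgetting the indexing by Z loses nothing.

    It follows that relating the class of a strong loop to the class of the edge
    loop that it spells is a bijection p. The group structure on the strong side
    is transported along p, and it is the one given by concatenation because the
    edge loop of a concatenation is literally the concatenation of the edge
    loops. *)

(** * Simplices given by lists of vertices *)

Definition span (T : Type) (s : list T) : Ensemble T := fun z => List.In z s.

Lemma ensemble_ext (T : Type) (S S' : Ensemble T) : (forall z, S z <-> S' z) -> S = S'.
Proof.
intros H. extensionality z. now apply propositional_extensionality.
Qed.

Lemma span_couple (T : Type) (u v : T) : Couple T u v = span (u :: v :: nil).
Proof.
apply ensemble_ext; intros z; split.
- intros H; destruct H; [left | right; left]; reflexivity.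
- intros [<-|[<-|[]]]; constructor.
Qed.

Lemma span_triple (T : Type) (u v w : T) : Triple T u v w = span (u :: v :: w :: nil).
Proof.
apply ensemble_ext; intros z; split.
- intros H; destruct H; unfold span; simpl; auto.
- intros [<-|[<-|[<-|[]]]]; constructor.
Qed.

(** * Contractions of edge walks *)

Section LoopsAsSequences.
Variable K : complex.
Implicit Types (u v : K) (s t p q l : list K) (w : Z -> K).

Lemma simplex_incl s t : simplex (span t) -> incl s t -> s <> nil -> simplex (span s).
Proof.
intros H Hi Hn. apply simplex_face with (span t); [exact H | exact Hi |].
destruct s as [|a s]; [easy|]. exists a. now left.
Qed.

Lemma simplex_span_twice u : simplex (span (u :: u :: nil)).
Proof.
apply (simplex_face (simplex_singleton u)).
- intros z [<-|[<-|[]]]; constructor.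
- exists u. now left.
Qed.

(** Relating lists rather than loops allows cutting and pasting; nothing is lost
    by [contracts_edge_step]. *)
Definition contracts_to : relation (list K) := clos_refl_sym_trans _ (@contraction K).

Lemma contracts_cat p q s t : contracts_to s t -> contracts_to (p ++ s ++ q) (p ++ t ++ q).
Proof.
apply (rst_map (f := fun s => p ++ s ++ q)). intros a a' H.
now apply rst_step, contraction_cat.
Qed.

Lemma contracts_cons u s t : contracts_to s t -> contracts_to (u :: s) (u :: t).
Proof.
intros H. generalize (contracts_cat (u :: nil) nil H). now rewrite !app_nil_r.
Qed.

Lemma contracts_repeat_left u n q : contracts_to (repeat u n ++ u :: q) (u :: q).
Proof.
induction n as [|n IH]; [apply rst_refl|].
eapply rst_trans; [exact (contracts_cons u IH)|].
apply rst_step. exact (contract_repeat nil u q).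
Qed.

Lemma contracts_repeat_right u n p : contracts_to (p ++ u :: repeat u n) (p ++ u :: nil).
Proof.
induction n as [|n IH]; [apply rst_refl|].
eapply rst_trans; [|exact IH]. apply rst_step. exact (contract_repeat p u _).
Qed.

(** An expansion also preserves walks, since the edges that it creates are faces
    of the triangle. With [contraction_walk], being a walk is invariant under
    contractions in both directions. *)
Lemma contraction_walk_back s t u l : contraction s t -> t = u :: l ->
  exists m, s = u :: m /\ forall v, edge_walk u l v -> edge_walk u m v.
Proof.
intros H; destruct H as [p a b c q H|p a q].
- assert (Hab : simplex (Couple K a b) /\ simplex (Couple K b c)).
  { rewrite span_triple in H. rewrite !span_couple.
    split; (apply (simplex_incl H); [intros z; simpl; tauto | easy]). }
  destruct p as [|d p]; simpl; intros E; injection E as <- <-; eexists;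
    (split; [reflexivity|]); intros z Hz.
  + simpl in *. tauto.
  + apply edge_walk_split in Hz. destruct Hz as [H1 [_ H2]].
    change (a :: b :: c :: q) with ((a :: nil) ++ b :: c :: q). rewrite app_assoc.
    apply edge_walk_cat with a; [exact H1|]. simpl. tauto.
- assert (Haa : simplex (Couple K a a)).
  { rewrite span_couple. apply simplex_span_twice. }
  destruct p as [|d p]; simpl; intros E; injection E as <- <-; eexists;
    (split; [reflexivity|]); intros z Hz.
  + simpl in *. tauto.
  + apply edge_walk_split in Hz. destruct Hz as [H1 H2].
    change (a :: a :: q) with ((a :: nil) ++ a :: q). rewrite app_assoc.
    apply edge_walk_cat with a; [exact H1|]. simpl. tauto.
Qed.

Variable x : K.

Definition is_edge_loop s : Prop := exists l, s = x :: l /\ edge_walk x l x.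

Lemma contracts_edge_loop s t : contracts_to s t -> is_edge_loop s <-> is_edge_loop t.
Proof.
intros H; induction H as [s t H|s|s t _ IH|s t r _ IH1 _ IH2]; try tauto.
split; intros [l [E Hl]].
- destruct (contraction_walk H E) as [m [Em Hm]]. exists m. auto.
- destruct (contraction_walk_back H E) as [m [Em Hm]]. exists m. auto.
Qed.

(** Every list met between two edge loops is itself an edge loop. *)
Lemma contracts_edge_step (a b : edge_loop x) :
  contracts_to (x :: proj1_sig a) (x :: proj1_sig b) ->
  clos_refl_sym_trans _ (@edge_step K x) a b.
Proof.
remember (x :: proj1_sig a) as s eqn:Es. remember (x :: proj1_sig b) as t eqn:Et.
intros H. revert a b Es Et.
induction H as [s t H|s|s t _ IH|s t r H1 IH1 _ IH2]; intros a b Es Et; subst.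
- now apply rst_step.
- injection Et as E. replace b with a; [apply rst_refl|].
  destruct a, b. now apply subset_eq_compat.
- apply rst_sym. now apply IH.
- destruct (proj1 (contracts_edge_loop H1)) as [l [-> Hl]].
  { exists (proj1_sig a). split; [reflexivity | exact (proj2_sig a)]. }
  apply rst_trans with (exist _ l Hl); auto.
Qed.

(** * Adjacent sequences and their edge walks *)

Fixpoint seg w (n : Z) (d : nat) : list K :=
  match d with O => nil | S d' => w n :: seg w (n + 1) d' end.

Lemma seg_add w d e n : seg w n (d + e) = seg w n d ++ seg w (n + Z.of_nat d) e.
Proof.
revert n; induction d as [|d IH]; intros n.
- simpl. f_equal. lia.
- cbn [Nat.add seg app]. rewrite IH. do 3 f_equal. lia.
Qed.

Lemma seg_last w d n : seg w n (S d) = seg w n d ++ w (n + Z.of_nat d) :: nil.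
Proof. rewrite <- Nat.add_1_r. apply seg_add. Qed.

Lemma seg_const w u d n : (forall k, n <= k < n + Z.of_nat d -> w k = u) ->
  seg w n d = repeat u d.
Proof.
revert n; induction d as [|d IH]; intros n H; [reflexivity|]. cbn [seg repeat].
rewrite (H n), IH; [reflexivity | intros k Hk; apply H; lia | lia].
Qed.

Lemma seg_ext w w' d d' n n' : d = d' ->
  (forall k, 0 <= k < Z.of_nat d -> w (n + k) = w' (n' + k)) -> seg w n d = seg w' n' d'.
Proof.
intros <-. revert n n'; induction d as [|d IH]; intros n n' H; [reflexivity|]. cbn [seg].
f_equal.
- generalize (H 0). rewrite !Z.add_0_r. intros ->; [reflexivity | lia].
- apply IH. intros k Hk. rewrite <- !Z.add_assoc. apply H. lia.
Qed.

Lemma nth_seg w u d n i : (i < d)%nat -> nth i (seg w n d) u = w (n + Z.of_nat i).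
Proof.
revert n i; induction d as [|d IH]; intros n i Hi; [lia|].
destruct i as [|i]; cbn [seg nth].
- f_equal. lia.
- rewrite IH by lia. f_equal. lia.
Qed.

Lemma length_seg w d n : length (seg w n d) = d.
Proof. revert n; induction d as [|d IH]; intros n; simpl; auto. Qed.

Definition adjacent w w' : Prop :=
  forall n, simplex (span (w n :: w (n + 1) :: w' n :: w' (n + 1) :: nil)).

Lemma adjacent_sym w w' : adjacent w w' -> adjacent w' w.
Proof. intros H n. apply (simplex_incl (H n)); [intros z; simpl; tauto | easy]. Qed.

(** The strip between two adjacent rows is swept from right to left: each square
    is crossed by replacing the corner w n, w (n + 1), w' (n + 1) first by its
    diagonal, and then by the corner w n, w' n, w' (n + 1). *)
Lemma contracts_ladder w w' d n : adjacent w w' ->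
  contracts_to (seg w n (S d) ++ w' (n + Z.of_nat d) :: nil) (w n :: seg w' n (S d)).
Proof.
intros H. revert n; induction d as [|d IH]; intros n.
- cbn [seg app]. replace (n + Z.of_nat 0) with n by lia. apply rst_refl.
- generalize (contracts_cons (w n) (IH (n + 1))). cbn [seg app].
  replace (n + 1 + Z.of_nat d) with (n + Z.of_nat (S d)) by lia.
  intros Hc. eapply rst_trans; [exact Hc|].
  eapply rst_trans; [|apply rst_sym]; apply rst_step.
  + apply (@contract_triangle K nil). rewrite span_triple.
    apply (simplex_incl (H n)); [intros z; simpl; tauto | easy].
  + apply (@contract_triangle K nil). rewrite span_triple.
    apply (simplex_incl (H n)); [intros z; simpl; tauto | easy].
Qed.

Lemma contracts_adjacent w w' N d : adjacent w w' -> w N = x -> w' N = x ->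
  w (N + Z.of_nat d) = x -> w' (N + Z.of_nat d) = x ->
  contracts_to (seg w N (S d)) (seg w' N (S d)).
Proof.
intros H h1 h2 h3 h4. generalize (contracts_ladder d N H). rewrite h1, h4. intros Hl.
apply rst_trans with (seg w N (S d) ++ x :: nil); [|eapply rst_trans; [exact Hl|]].
- rewrite seg_last, h3, <- app_assoc. apply rst_sym, (contracts_repeat_right x 1).
- cbn [seg]. rewrite h2. apply rst_step. exact (contract_repeat nil x _).
Qed.

Definition loop_seq w : Prop :=
  (forall n, simplex (span (w n :: w (n + 1) :: nil))) /\
  (exists N, forall n, n <= N -> w n = x) /\ (exists M, forall n, M <= n -> w n = x).

Definition homotopic_seq : relation (Z -> K) :=
  clos_refl_sym_trans _ (fun w w' => loop_seq w /\ loop_seq w' /\ adjacent w w').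

Lemma homotopic_loop_seq w w' : homotopic_seq w w' -> loop_seq w <-> loop_seq w'.
Proof. intros H; induction H; tauto. Qed.

(** The bounds N and d are not unique: a larger window adds repetitions of x. *)
Definition spells w l : Prop :=
  exists N d, (forall n, n <= N -> w n = x) /\ (forall n, N + Z.of_nat d <= n -> w n = x) /\
    l = seg w (N + 1) d.

Lemma seg_walk w d n : (forall n, simplex (span (w n :: w (n + 1) :: nil))) ->
  edge_walk (w n) (seg w (n + 1) d) (w (n + Z.of_nat d)).
Proof.
intros H. revert n; induction d as [|d IH]; intros n.
- simpl. f_equal. lia.
- cbn [seg edge_walk]. rewrite span_couple. split; [apply H|].
  replace (n + Z.of_nat (S d)) with (n + 1 + Z.of_nat d) by lia. apply IH.
Qed.

Lemma spells_walk w l : loop_seq w -> spells w l -> edge_walk x l x.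
Proof.
intros [Hw _] (N & d & HN & HM & ->). generalize (seg_walk d N Hw).
rewrite HN, HM by lia. easy.
Qed.

Lemma loop_seq_spells w : loop_seq w -> exists l, spells w l.
Proof.
intros (_ & [N HN] & [M HM]).
exists (seg w (N + 1) (Z.to_nat (M - N))), N, (Z.to_nat (M - N)).
repeat split; [exact HN|]. intros n Hn. apply HM. lia.
Qed.

Lemma contracts_widen w N d N' d' : (forall n, n <= N -> w n = x) ->
  (forall n, N + Z.of_nat d <= n -> w n = x) ->
  N' <= N -> N + Z.of_nat d <= N' + Z.of_nat d' ->
  contracts_to (x :: seg w (N + 1) d) (seg w N' (S d')).
Proof.
intros HN HM h1 h2.
set (i := Z.to_nat (N - N')). set (j := Z.to_nat (N' + Z.of_nat d' - N - Z.of_nat d)).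
replace (S d') with (i + (S d + j))%nat by lia.
rewrite !seg_add. replace (N' + Z.of_nat i) with N by lia.
rewrite (seg_const (n := N') (d := i) (u := x)) by (intros; apply HN; lia).
rewrite (seg_const (n := N + _) (d := j) (u := x)) by (intros; apply HM; lia).
apply rst_sym.
apply rst_trans with (repeat x i ++ seg w N (S d)).
- rewrite seg_last, HM by lia. rewrite <- app_assoc, app_assoc. simpl.
  eapply rst_trans; [apply contracts_repeat_right|]. rewrite app_assoc. apply rst_refl.
- cbn [seg]. rewrite HN by lia. apply contracts_repeat_left.
Qed.

Lemma spells_adjacent w w' l l' : adjacent w w' -> spells w l -> spells w' l' ->
  contracts_to (x :: l) (x :: l').
Proof.
intros H (N & d & HN & HM & ->) (N' & d' & HN' & HM' & ->).
set (P := Z.min N N'). set (e := Z.to_nat (Z.max (N + Z.of_nat d) (N' + Z.of_nat d') - P)).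
apply rst_trans with (seg w P (S e)); [apply contracts_widen; (assumption || lia)|].
apply rst_trans with (seg w' P (S e));
  [|apply rst_sym, contracts_widen; (assumption || lia)].
apply contracts_adjacent; [exact H | apply HN | apply HN' | apply HM | apply HM']; lia.
Qed.

Lemma adjacent_refl w : loop_seq w -> adjacent w w.
Proof.
intros [H _] n. apply (simplex_incl (H n)); [intros z; simpl; tauto | easy].
Qed.

(** The windows of two sequences may differ; [spells_adjacent] compares both with
    a common larger one. Applied to a sequence and itself, it shows that the
    choice of the window is immaterial. *)
Lemma homotopic_seq_contracts w w' : homotopic_seq w w' -> loop_seq w ->
  forall l l', spells w l -> spells w' l' -> contracts_to (x :: l) (x :: l').
Proof.
intros H; induction H as [w w' (_ & _ & H)|w|w w' H IH|w v w' H1 IH1 H2 IH2];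
  intros Hw l l' Hl Hl'.
- exact (spells_adjacent H Hl Hl').
- exact (spells_adjacent (adjacent_refl Hw) Hl Hl').
- apply rst_sym, IH; auto. now apply (homotopic_loop_seq H).
- assert (Hv : loop_seq v) by now apply (homotopic_loop_seq H1).
  destruct (loop_seq_spells Hv) as [m Hm]. apply rst_trans with (x :: m); [exact (IH1 Hw _ _ Hl Hm) | exact (IH2 Hv _ _ Hm Hl')].
Qed.

(** * Repetitions and translations *)

Definition stutter (k : Z) w : Z -> K := fun n => if n <=? k then w n else w (n - 1).

Lemma stutter_loop k w : loop_seq w -> loop_seq (stutter k w).
Proof.
intros (H & [N HN] & [M HM]). repeat split.
- intros n. unfold stutter. destruct (Z.leb_spec n k), (Z.leb_spec (n + 1) k); try lia.
  + apply H.
  + replace (n + 1 - 1) with n by lia.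
    apply (simplex_incl (H n)); [intros z; simpl; tauto | easy].
  + replace (n + 1 - 1) with (n - 1 + 1) by lia. apply H.
- exists N. intros n Hn. unfold stutter. destruct (n <=? k); apply HN; lia.
- exists (M + 1). intros n Hn. unfold stutter. destruct (n <=? k); apply HM; lia.
Qed.

Lemma stutter_adjacent k w : loop_seq w -> adjacent (stutter k w) (stutter (k + 1) w).
Proof.
intros [H _] n. unfold stutter.
destruct (Z.leb_spec n k), (Z.leb_spec (n + 1) k), (Z.leb_spec n (k + 1)),
  (Z.leb_spec (n + 1) (k + 1)); try lia; replace (n + 1 - 1) with n by lia.
- apply (simplex_incl (H n)); [intros z; simpl; tauto | easy].
- apply (simplex_incl (H n)); [intros z; simpl; tauto | easy].
- generalize (H (n - 1)). replace (n - 1 + 1) with n by lia. intros H'.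
  apply (simplex_incl H'); [intros z; simpl; tauto | easy].
- generalize (H (n - 1)). replace (n - 1 + 1) with n by lia. intros H'.
  apply (simplex_incl H'); [intros z; simpl; tauto | easy].
Qed.

(** Moving the repetition from k to k + 1 changes only the value at k + 1, from
    w k to w (k + 1). Far enough to the right, the sequence is constant and the
    repetition is invisible. *)
Lemma stutter_homotopic k w : loop_seq w -> homotopic_seq (stutter k w) w.
Proof.
intros Hw. assert (Hw' := Hw). destruct Hw' as (_ & _ & [M HM]).
assert (H : forall i, homotopic_seq (stutter k w) (stutter (k + Z.of_nat i) w)).
{ induction i as [|i IH].
  - replace (k + Z.of_nat 0) with k by lia. apply rst_refl.
  - eapply rst_trans; [exact IH|].
    replace (k + Z.of_nat (S i)) with (k + Z.of_nat i + 1) by lia.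
    apply rst_step. auto using stutter_loop, stutter_adjacent. }
replace w with (stutter (k + Z.of_nat (Z.to_nat (M - k))) w) at 2; [apply H|].
extensionality n. unfold stutter. destruct (Z.leb_spec n (k + Z.of_nat (Z.to_nat (M - k))));
  [reflexivity|]. rewrite !HM by lia. reflexivity.
Qed.

Lemma shift_loop N w : loop_seq w -> loop_seq (fun n => w (n - N)).
Proof.
intros (H & [P HP] & [M HM]). repeat split.
- intros n. replace (n + 1 - N) with (n - N + 1) by lia. apply H.
- exists (P + N). intros n Hn. apply HP. lia.
- exists (M + N). intros n Hn. apply HM. lia.
Qed.

(** A repetition far to the left is a translation by one. *)
Lemma shift_homotopic N w : loop_seq w -> homotopic_seq (fun n => w (n - N)) w.
Proof.
assert (H1 : forall f, loop_seq f -> homotopic_seq (fun n => f (n - 1)) f).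
{ intros f Hf. assert (Hf' := Hf). destruct Hf' as (_ & [P HP] & _).
  (* Up to P, the value x of f does not see the translation. *)
  replace (fun n => f (n - 1)) with (stutter P f); [now apply stutter_homotopic|].
  extensionality n. unfold stutter. destruct (Z.leb_spec n P); [|reflexivity].
  rewrite !HP by lia. reflexivity. }
assert (H2 : forall i f, loop_seq f -> homotopic_seq (fun n => f (n - Z.of_nat i)) f).
{ induction i as [|i IH]; intros f Hf.
  - replace (fun n => f (n - Z.of_nat 0)) with f; [apply rst_refl|].
    extensionality n. f_equal. lia.
  - eapply rst_trans; [|exact (IH f Hf)].
    replace (fun n => f (n - Z.of_nat (S i)))
      with (fun n => (fun k => f (k - Z.of_nat i)) (n - 1)).
    + exact (H1 _ (shift_loop (Z.of_nat i) Hf)).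
    + extensionality n. f_equal. lia. }
intros Hw. destruct (Z.le_ge_cases 0 N) as [HN|HN].
- rewrite <- (Z2Nat.id N HN). now apply H2.
- apply rst_sym.
  generalize (H2 (Z.to_nat (- N)) (fun n => w (n - N)) (shift_loop N Hw)).
  replace (fun n => w (n - Z.of_nat (Z.to_nat (- N)) - N)) with w; [easy|].
  extensionality n. f_equal. lia.
Qed.

(** * Sequences and edge loops *)

(** The list is continued by x on both sides: on the left by its first entry, as
    [Z.to_nat] truncates, which is x for an edge loop; on the right by the
    default value. *)
Definition seq_of s : Z -> K := fun n => nth (Z.to_nat n) s x.

Lemma seq_of_loop l : edge_walk x l x -> loop_seq (seq_of (x :: l)).
Proof.
intros H. split; [|split].
- intros n. unfold seq_of.
  destruct (Z.ltb_spec n 0) as [Hn|Hn].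
  { replace (Z.to_nat n) with 0%nat by lia. replace (Z.to_nat (n + 1)) with 0%nat by lia.
    apply simplex_span_twice. }
  replace (Z.to_nat (n + 1)) with (S (Z.to_nat n)) by lia.
  generalize (Z.to_nat n). clear n Hn. intros i.
  enough (E : forall l u i, edge_walk u l x ->
    simplex (span (nth i (u :: l) x :: nth (S i) (u :: l) x :: nil))) by now apply E.
  clear H l i. induction l as [|v l IH]; intros u i Hu.
  + simpl in Hu. subst u. destruct i as [|[|i]]; apply simplex_span_twice.
  + destruct Hu as [H1 H2]. destruct i as [|i].
    * rewrite span_couple in H1. exact H1.
    * exact (IH v i H2).
- exists 0. intros n Hn. unfold seq_of. now replace (Z.to_nat n) with 0%nat by lia.
- exists (Z.of_nat (length l) + 1). intros n Hn. unfold seq_of.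
  apply nth_overflow. simpl. lia.
Qed.

Lemma seq_of_spells l : edge_walk x l x -> spells (seq_of (x :: l)) l.
Proof.
intros Hl. destruct (edge_walk_last Hl) as [p Hp].
assert (Ep : length p = length l).
{ apply (f_equal (@length K)) in Hp. rewrite length_app in Hp. simpl in Hp. lia. }
exists 0, (length l). repeat split.
- intros n Hn. unfold seq_of. now replace (Z.to_nat n) with 0%nat by lia.
- intros n Hn. unfold seq_of. rewrite Hp, app_nth2 by lia.
  destruct (Z.to_nat n - length p)%nat as [|[|i]]; reflexivity.
- apply nth_ext with x x; [now rewrite length_seg|]. intros i Hi.
  rewrite nth_seg by exact Hi. unfold seq_of.
  now replace (Z.to_nat (0 + 1 + Z.of_nat i)) with (S i) by lia.
Qed.

Lemma spells_shift w l : spells w l -> exists N, w = fun n => seq_of (x :: l) (n - N).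
Proof.
intros (N & d & HN & HM & ->). exists N. extensionality n. unfold seq_of.
destruct (Z.leb_spec n N).
- replace (Z.to_nat (n - N)) with 0%nat by lia. now apply HN.
- replace (Z.to_nat (n - N)) with (S (Z.to_nat (n - N - 1))) by lia. cbn [nth].
  destruct (Z.leb_spec n (N + Z.of_nat d)).
  + rewrite nth_seg by lia. f_equal. lia.
  + rewrite nth_overflow by (rewrite length_seg; lia). apply HM. lia.
Qed.

Lemma spells_homotopic w l : loop_seq w -> spells w l ->
  homotopic_seq w (seq_of (x :: l)).
Proof.
intros Hw Hl. destruct (spells_shift Hl) as [N EN].
rewrite EN at 1. apply shift_homotopic, seq_of_loop, (spells_walk Hw Hl).
Qed.

Lemma seq_of_repeat p u q :
  seq_of (p ++ u :: u :: q) = stutter (Z.of_nat (length p)) (seq_of (p ++ u :: q)).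
Proof.
extensionality n. unfold stutter, seq_of.
destruct (Z.leb_spec n (Z.of_nat (length p))).
- destruct (Nat.lt_ge_cases (Z.to_nat n) (length p)).
  + now rewrite !app_nth1 by lia.
  + rewrite !app_nth2 by lia. now replace (Z.to_nat n - length p)%nat with 0%nat by lia.
- rewrite !app_nth2 by lia.
  replace (Z.to_nat n - length p)%nat with (S (Z.to_nat (n - 1) - length p)) by lia.
  reflexivity.
Qed.

(** A triangle u, v, w is contracted by overwriting v with w, which leaves a
    repetition of w to be removed. *)
Lemma edge_step_homotopic (a b : edge_loop x) : edge_step a b ->
  homotopic_seq (seq_of (x :: proj1_sig a)) (seq_of (x :: proj1_sig b)).
Proof.
assert (Hloop : forall s, is_edge_loop s -> loop_seq (seq_of s)).
{ intros s (l & -> & Hl). now apply seq_of_loop. }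
assert (Ha : is_edge_loop (x :: proj1_sig a)) by (exists (proj1_sig a); split; [easy | apply (proj2_sig a)]).
assert (Hb : is_edge_loop (x :: proj1_sig b)) by (exists (proj1_sig b); split; [easy | apply (proj2_sig b)]).
unfold edge_step. revert Ha Hb. generalize (x :: proj1_sig a) (x :: proj1_sig b).
clear a b. intros s t Hs Ht H.
assert (Hrep : forall p u q, is_edge_loop (p ++ u :: q) ->
  homotopic_seq (seq_of (p ++ u :: u :: q)) (seq_of (p ++ u :: q))).
{ intros p u q Hp. rewrite seq_of_repeat. now apply stutter_homotopic, Hloop. }
destruct H as [p u v w q H|p u q]; [|now apply Hrep].
assert (E : forall r, p ++ u :: r = (p ++ u :: nil) ++ r) by (intros; now rewrite <- app_assoc).
apply rst_trans with (seq_of (p ++ u :: w :: w :: q)).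
2: { rewrite (E (w :: w :: q)), (E (w :: q)). apply Hrep. now rewrite <- E. }
apply rst_step. split; [now apply Hloop|]. split.
{ apply Hloop. apply (@contracts_edge_loop _ (p ++ u :: w :: q)); [|exact Ht].
  apply rst_step. rewrite (E (w :: w :: q)), (E (w :: q)). apply contract_repeat. }
rewrite span_triple in H.
set (f := seq_of (p ++ u :: v :: w :: q)). set (g := seq_of (p ++ u :: w :: w :: q)).
set (c := Z.of_nat (length p)).
assert (Hf : f c = u /\ f (c + 1) = v /\ f (c + 2) = w).
{ unfold f, seq_of, c. repeat split; rewrite app_nth2 by lia.
  - now replace (Z.to_nat (Z.of_nat (length p)) - length p)%nat with 0%nat by lia.
  - now replace (Z.to_nat (Z.of_nat (length p) + 1) - length p)%nat with 1%nat by lia.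
  - now replace (Z.to_nat (Z.of_nat (length p) + 2) - length p)%nat with 2%nat by lia. }
assert (Hg : g (c + 1) = w).
{ unfold g, seq_of, c. rewrite app_nth2 by lia.
  now replace (Z.to_nat (Z.of_nat (length p) + 1) - length p)%nat with 1%nat by lia. }
assert (Hfg : forall n, n <> c + 1 -> g n = f n).
{ intros n Hn. unfold f, g, seq_of, c in *.
  destruct (Nat.lt_ge_cases (Z.to_nat n) (length p)) as [h|h].
  - now rewrite !app_nth1 by lia.
  - rewrite !app_nth2 by lia.
    destruct (Z.to_nat n - length p)%nat as [|[|i]] eqn:Ei; [reflexivity|lia|reflexivity]. }
destruct Hf as (Hf1 & Hf2 & Hf3).
intros n. destruct (Z.eq_dec n c) as [->|H1]; [|destruct (Z.eq_dec n (c + 1)) as [->|H2]].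
- rewrite Hg, (Hfg c) by lia. rewrite Hf1, Hf2.
  apply (simplex_incl H); [intros z; simpl; tauto | easy].
- rewrite Hg, (Hfg (c + 1 + 1)) by lia. replace (c + 1 + 1) with (c + 2) by lia.
  rewrite Hf2, Hf3. apply (simplex_incl H); [intros z; simpl; tauto | easy].
- rewrite !Hfg by lia.
  apply (simplex_incl (proj1 (Hloop _ Hs) n)); [intros z; simpl; tauto | easy].
Qed.

(** The edge-path group of a complex may thus be computed with sequences indexed
    by Z and grid homotopies. *)
Lemma homotopic_seq_edge_class w w' (a b : edge_loop x) : loop_seq w -> loop_seq w' ->
  spells w (proj1_sig a) -> spells w' (proj1_sig b) ->
  homotopic_seq w w' <-> cls (@edge_step K x) a = cls (@edge_step K x) b.
Proof.
intros Hw Hw' Ha Hb. split.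
- intros H. apply cls_eq, contracts_edge_step.
  exact (homotopic_seq_contracts H Hw Ha Hb).
- intros H. apply rst_trans with (seq_of (x :: proj1_sig a)); [now apply spells_homotopic|].
  apply rst_trans with (seq_of (x :: proj1_sig b)); [|now apply rst_sym, spells_homotopic].
  apply (rst_map (f := fun a : edge_loop x => seq_of (x :: proj1_sig a)) edge_step_homotopic).
  exact (cls_inj H).
Qed.

End LoopsAsSequences.

(** * Atlases with finite, connected and nested local groupoids *)

(** These are the properties of the line and of the plane on which the extension
    of maps on points depends. The last one fails for general atlases, where the
    object sets of two comparable local groupoids only overlap. *)
Record tame (B : atlas) : Prop := Tame {
  tame_finite : forall b : idx B, exists s, forall z, obj (gpd b) z -> List.In z s;
  tame_inhabited : forall b : idx B, exists z, obj (gpd b) z;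
  tame_connected : forall (b : idx B) z t, obj (gpd b) z -> obj (gpd b) t ->
    inhabited (hom (gpd b) z t);
  tame_nested : forall b c : idx B, le b c -> forall z, obj (gpd b) z -> obj (gpd c) z
}.

Lemma tame_line : tame line.
Proof.
split.
- intros [n|n]; [exists (n :: nil) | exists (n :: n + 1 :: nil)]; intros z Hz; simpl in *; intuition.
- intros [n|n]; exists n; simpl; auto.
- intros b z t Hz Ht. exact (inhabits (conj Hz Ht)).
- intros b c H. exact H.
Qed.

Lemma tame_prod (B C : atlas) : tame B -> tame C -> tame (prod_atlas B C).
Proof.
intros [f1 i1 c1 n1] [f2 i2 c2 n2]. split.
- intros [b c]. destruct (f1 b) as [s Hs], (f2 c) as [t Ht]. exists (list_prod s t).
  intros [z z'] [Hz Hz']. apply in_prod; auto.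
- intros [b c]. destruct (i1 b) as [z Hz], (i2 c) as [t Ht]. exists (z, t). now split.
- intros [b c] [z z'] [t t'] [Hz Hz'] [Ht Ht'].
  destruct (c1 b z t Hz Ht) as [f], (c2 c z' t' Hz' Ht') as [g]. exact (inhabits (f, g)).
- intros [b c] [b' c'] [h h'] [z z'] [Hz Hz']. split; [exact (n1 _ _ h _ Hz) | exact (n2 _ _ h' _ Hz')].
Qed.

Lemma hom_unique (X : Type) (G : groupoid X) y z (f g : hom G y z) :
  simply_connected G -> f = g.
Proof.
intros H. rewrite <- (comp_idr (hom_tgt g) f), <- (comp_invl (hom_tgt g) g), compA.
rewrite (H y (hom_src f) (comp f (hinv g))). apply comp_idl.
Qed.

Lemma tri_pt (B A : atlas) (f g : morphism B A) : tri f g -> forall z, f z = g z.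
Proof.
intros H z. destruct (covered z) as [b Hb], (H b) as [h Hh].
destruct (Hh z z (idm _ Hb)) as (hx & hy & E). exact (f_equal (@la_src A) E).
Qed.

Lemma cls_tri_pt (B A : atlas) (f g : morphism B A) :
  cls (@tri B A) f = cls (@tri B A) g -> forall z, f z = g z.
Proof.
intros H. apply cls_inj in H. induction H; intros t.
- now apply tri_pt.
- reflexivity.
- now symmetry.
- etransitivity; eauto.
Qed.

(** * Morphisms determined by their values on points *)

Section SimplyConnected.
Variable A : atlas.
Hypothesis infA : infimum A.
Hypothesis scA : forall a : idx A, simply_connected (gpd a).

Lemma id_arrow_unique (a : idx A) (x : A) (hx : obj (gpd a) x) (u : local_arrow A) :
  la_idx u = a -> la_src u = x -> la_tgt u = x -> u = id_arrow hx.
Proof.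
destruct u as [b y z f]; simpl. intros -> -> ->. unfold id_arrow. f_equal.
apply hom_unique, scA.
Qed.

Lemma tri_intro (B : atlas) (f g : morphism B A) :
  (forall z, f z = g z) -> (forall b, le (idx_map f b) (idx_map g b)) -> tri f g.
Proof.
intros H Hle. apply functional_extensionality in H. intros b. exists (Hle b). intros y z h.
destruct f as [f fi fm fo fa f1 f2 f3], g as [g gi gm go ga g1 g2 g3]; simpl in *. subst g.
exists (go b y (hom_src h)), (go b z (hom_tgt h)). f_equal. apply hom_unique, scA.
Qed.

Definition frame_index (s : Ensemble A) (H : local_frame s) : idx A :=
  proj1_sig (constructive_indefinite_description _ (infA H)).

Lemma frame_index_frame (s : Ensemble A) (H : local_frame s) : local_frame_at (frame_index H) s.
Proof. exact (proj1 (proj2_sig (constructive_indefinite_description _ (infA H)))). Qed.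

Lemma frame_index_initial (s : Ensemble A) (H : local_frame s) (a : idx A) : local_frame_at a s -> le (frame_index H) a.
Proof. exact (proj2 (proj2_sig (constructive_indefinite_description _ (infA H))) a). Qed.

Lemma frame_index_eq (s t : Ensemble A) (Hs : local_frame s) (Ht : local_frame t) :
  s = t -> frame_index Hs = frame_index Ht.
Proof. intros <-. now rewrite (proof_irrelevance _ Hs Ht). Qed.

Lemma local_frame_at_hom (a : idx A) (s : Ensemble A) y z : local_frame_at a s -> s y -> s z ->
  inhabited (hom (gpd a) y z).
Proof.
intros (_ & _ & c & _ & Hc) Hy Hz. destruct (Hc y Hy) as [f], (Hc z Hz) as [g].
exact (inhabits (comp (hinv f) g)).
Qed.

Lemma local_frame_at_obj (a : idx A) (s : Ensemble A) y : local_frame_at a s -> s y -> obj (gpd a) y.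
Proof. intros H Hy. destruct (local_frame_at_hom H Hy Hy) as [f]. exact (hom_src f). Qed.

Lemma local_frame_at_sub (a : idx A) (s t : Ensemble A) : local_frame_at a t -> Included A s t -> Inhabited A s ->
  local_frame_at a s.
Proof.
intros (_ & Hf & c & Hc & Ht) H Hi. repeat split; [exact Hi| |].
- exact (Finite_downward_closed _ t Hf s H).
- exists c. split; [exact Hc|]. intros z Hz. exact (Ht z (H z Hz)).
Qed.

Lemma finite_span (T : Type) (s : list T) : Finite T (span s).
Proof.
induction s as [|a s IH].
- replace (span (@nil T)) with (Empty_set T); [apply Empty_is_finite|].
  apply ensemble_ext; intros z; split; intros [].
- apply Finite_downward_closed with (Add T (span s) a).
  + now apply Add_preserves_Finite.
  + intros z [<-|Hz]; [right; constructor | now left].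
Qed.

(** Each index goes to the smallest local groupoid in which the image of its object
    set is a local frame. The arrows exist since a local frame lies in one
    component, and all equations between them hold by simple connectedness. *)
Section Realization.
Variables (B : atlas) (X : B -> A).
Hypothesis tameB : tame B.

Definition image_of (b : idx B) : Ensemble A := Im B A (obj (gpd b)) X.

Lemma image_of_inhabited b : Inhabited A (image_of b).
Proof.
destruct (tame_inhabited tameB b) as [z Hz]. exists (X z). now apply Im_intro with z.
Qed.

Hypothesis framed : forall b, local_frame (image_of b).

Lemma in_image b z : obj (gpd b) z -> image_of b (X z).
Proof. intros H. now apply Im_intro with z. Qed.

Definition realize_arr b y z (h : hom (gpd b) y z) :
    hom (gpd (frame_index (framed b))) (X y) (X z) :=
  proj1_sig (constructive_indefinite_description (fun _ => True)
    (match local_frame_at_hom (frame_index_frame (framed b))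
       (in_image (hom_src h)) (in_image (hom_tgt h))
     with inhabits f => ex_intro _ f I end)).

Lemma image_of_le b c : le b c -> Included A (image_of b) (image_of c).
Proof.
intros H z Hz. destruct Hz as [y Hy z ->]. apply in_image.
exact (tame_nested tameB H Hy).
Qed.

Definition realize : morphism B A.
Proof.
unshelve refine (@Morphism B A X (fun b => frame_index (framed b)) _ _ realize_arr _ _ _).
- intros b c H. apply frame_index_initial.
  apply local_frame_at_sub with (image_of c).
  + apply frame_index_frame.
  + now apply image_of_le.
  + apply image_of_inhabited.
- intros b z Hz.
  exact (local_frame_at_obj (frame_index_frame (framed b)) (in_image Hz)).
- intros. apply hom_unique, scA.
- intros. apply hom_unique, scA.
- intros. apply hom_unique, scA.
Defined.

(** The smallest index depends only on the image, not on the cell. A map which is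
    constant on several cells is therefore sent to one and the same identity
    arrow there, as stabilization requires. *)
Lemma realize_push (x : A) (hx : local_frame (Singleton A x))
    (h : obj (gpd (frame_index hx)) x) (u : local_arrow B) :
  (forall z, obj (gpd (la_idx u)) z -> X z = x) -> push realize u = id_arrow h.
Proof.
intros H. apply id_arrow_unique; simpl.
- apply frame_index_eq, ensemble_ext. intros y; split.
  + intros Hy. destruct Hy as [z Hz y ->]. rewrite (H z Hz). constructor.
  + intros Hy. destruct Hy. rewrite <- (H _ (hom_src (la_arr u))).
    apply in_image, (hom_src (la_arr u)).
- apply H, (hom_src (la_arr u)).
- apply H, (hom_tgt (la_arr u)).
Qed.

End Realization.

Lemma morphism_frame (B : atlas) (f : morphism B A) : tame B ->
  forall b, local_frame_at (idx_map f b) (image_of (B := B) f b).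
Proof.
intros tB b. destruct (tame_inhabited tB b) as [z Hz]. repeat split.
- now apply image_of_inhabited.
- destruct (tame_finite tB b) as [s Hs].
  apply Finite_downward_closed with (span (map f s)); [apply finite_span|].
  intros y Hy. destruct Hy as [t Ht y ->]. apply in_map, Hs, Ht.
- exists (f z). split; [exact (obj_map f Hz)|].
  intros y Hy. destruct Hy as [t Ht y ->].
  destruct (tame_connected tB Hz Ht) as [g]. exact (inhabits (arr_map f g)).
Qed.

(** Both morphisms lie above the realization of their common map on points. *)
Lemma cls_tri_eq (B : atlas) (f g : morphism B A) : tame B -> (forall z, f z = g z) ->
  cls (@tri B A) f = cls (@tri B A) g.
Proof.
intros tB H.
assert (framed : forall b, local_frame (image_of (B := B) f b)).
{ intros b. exists (idx_map f b). now apply morphism_frame. }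
apply cls_eq. apply rst_trans with (realize tB framed); [apply rst_sym|]; apply rst_step;
  apply tri_intro; try easy; intros b; apply frame_index_initial.
- now apply morphism_frame.
- replace (image_of (B := B) f b) with (image_of (B := B) g b); [now apply morphism_frame|].
  unfold image_of. f_equal. extensionality z. now symmetry.
Qed.

(** * Strong homotopy classes as classes of sequences *)

Notation K := (vietoris A).
Variable x : A.

Lemma singleton_frame : local_frame (Singleton A x).
Proof. exact (simplex_singleton (c := K) x). Qed.

Lemma singleton_obj : obj (gpd (frame_index singleton_frame)) x.
Proof. exact (local_frame_at_obj (frame_index_frame singleton_frame) (In_singleton A x)). Qed.

Lemma tame_plane : tame (prod_atlas line line).
Proof. exact (tame_prod tame_line tame_line). Qed.

Lemma stabilizes_loop_seq (l : morphism line A) :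
  stabilizes_left l x -> stabilizes_right l x -> loop_seq (K := K) x l.
Proof.
intros (a & ha & N & HN) (b & hb & M & HM). split; [|split].
- intros n. apply (simplex_face (c := K) (s := image_of (B := line) l (Edge n))).
  + exists (idx_map l (Edge n)). apply morphism_frame, tame_line.
  + intros z [<-|[<-|[]]]; apply in_image; simpl; auto.
  + exists (l n). now left.
- exists (N - 1). intros n Hn. exact (f_equal (@la_src A) (HN n ltac:(lia))).
- exists (M + 1). intros n Hn. exact (f_equal (@la_src A) (HM n ltac:(lia))).
Qed.

Lemma span_image (B : atlas) (X : B -> A) (b : idx B) s : tame B -> simplex (c := K) (span s) ->
  (forall z, obj (gpd b) z -> List.In (X z) s) -> local_frame (image_of X b).
Proof.
intros tB Hs H. apply (simplex_face (c := K) Hs).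
- intros y Hy. destruct Hy as [z Hz y ->]. now apply H.
- now apply image_of_inhabited.
Qed.

Lemma loop_seq_realized w : loop_seq (K := K) x w ->
  exists l : morphism line A, stabilizes_left l x /\ stabilizes_right l x /\ pt_map l = w.
Proof.
intros (H & [N HN] & [M HM]).
assert (framed : forall s, local_frame (image_of (B := line) w s)).
{ intros [n|n]; apply span_image with (w n :: w (n + 1) :: nil); auto using tame_line; simpl.
  - intros z ->. auto.
  - intros z [->| ->]; auto. }
exists (realize tame_line framed). repeat split.
- exists (frame_index singleton_frame), singleton_obj, N.
  intros n Hn. apply realize_push. intros z [->| ->]; apply HN; lia.
- exists (frame_index singleton_frame), singleton_obj, M.
  intros n Hn. apply realize_push. intros z [->| ->]; apply HM; lia.
Qed.

Definition traces (c : pi1 x) (w : Z -> A) : Prop :=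
  exists l (hl : stabilizes_left l x) (hr : stabilizes_right l x),
    pt_map l = w /\ c = loop_class hl hr.

Lemma loop_class_eq (l l' : morphism line A) (hl : stabilizes_left l x)
    (hr : stabilizes_right l x) (hl' : stabilizes_left l' x) (hr' : stabilizes_right l' x) :
  pt_map l = pt_map l' -> loop_class hl hr = loop_class hl' hr'.
Proof.
intros E. unfold loop_class. f_equal. apply subset_eq_compat.
assert (H : cls (@tri line A) l = cls (@tri line A) l').
{ apply cls_tri_eq; [exact tame_line|]. intros z. now rewrite E. }
exact H.
Qed.

Lemma traces_unique c c' w : traces c w -> traces c' w -> c = c'.
Proof.
intros (l & hl & hr & E & ->) (l' & hl' & hr' & E' & ->). apply loop_class_eq. congruence.
Qed.

(** The homotopy has w as its rows up to 0 and w' as its rows from 1 on; every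
    unit square then has its values among the four corners of a square between w
    and w'. *)
Lemma traces_adjacent c w w' : loop_seq (K := K) x w -> loop_seq (K := K) x w' ->
  adjacent (K := K) w w' -> traces c w -> traces c w'.
Proof.
intros Hw Hw' Hadj (l & hl & hr & El & ->).
destruct (loop_seq_realized Hw') as (l' & hl' & hr' & El').
exists l', hl', hr'. split; [exact El'|].
destruct Hw as (_ & [N HN] & [M HM]), Hw' as (_ & [N' HN'] & [M' HM']).
set (F := fun z : prod_atlas line line => (if snd z <=? 0 then w (fst z) else w' (fst z)) : A).
assert (framed : forall s, local_frame (image_of (B := prod_atlas line line) F s)).
{ intros [s t].
  set (n := match s with Vertex n | Edge n => n end).
  apply span_image with (w n :: w (n + 1) :: w' n :: w' (n + 1) :: nil);
    [exact tame_plane | apply Hadj|].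
  intros [i j] [Hi _]. unfold F; simpl in *.
  assert (i = n \/ i = n + 1) as [->| ->] by (destruct s; simpl in Hi; unfold n; lia);
    destruct (j <=? 0); tauto. }
(* The end conditions bound one end of an arrow; its cell extends by at most one. *)
assert (Hcell : forall s i k, in_cell s i -> in_cell s k -> i - 1 <= k <= i + 1).
{ intros [n|n] i k; simpl; lia. }
unfold loop_class. apply cls_eq, rst_step.
exists (realize tame_plane framed), 0, 1, (Z.min N N'), (Z.max M M').
exists (frame_index singleton_frame), (frame_index singleton_frame), singleton_obj, singleton_obj.
split; [|split].
- apply cls_tri_eq; [exact tame_line|]. intros n. simpl. unfold F; simpl. now rewrite El.
- apply cls_tri_eq; [exact tame_line|]. intros n. simpl. unfold F; simpl. now rewrite El'.
- intros [s [m m'] [k k'] [[Hm Hk] f]]; simpl in *.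
  split; intros Hu; apply realize_push; intros [i j] [Hi _]; unfold F; simpl in *.
  + pose proof (Hcell _ _ _ Hm Hi). destruct (j <=? 0); [apply HN | apply HN']; lia.
  + pose proof (Hcell _ _ _ Hk Hi). destruct (j <=? 0); [apply HM | apply HM']; lia.
Qed.

Lemma traces_homotopic c w w' : homotopic_seq (K := K) x w w' -> traces c w <-> traces c w'.
Proof.
intros H; induction H as [w w' (H1 & H2 & H3)| | |]; try tauto.
split; apply traces_adjacent; auto using adjacent_sym.
Qed.

(** The rows of a strong homotopy are loop sequences, consecutive rows are
    adjacent, and only finitely many of them separate the two ends. *)
Lemma homotopic_homotopic_seq (c c' : path x x) : homotopic c c' ->
  forall l l' : morphism line A, cls (@tri line A) l = proj1_sig c ->
  cls (@tri line A) l' = proj1_sig c' -> homotopic_seq (K := K) x l l'.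
Proof.
intros (H & N0 & N1 & M0 & M1 & a0 & a1 & h0 & h1 & E0 & E1 & Hend) l l' El El'.
set (row := fun (j n : Z) => H (n, j)).
assert (R0 : pt_map l = row N0).
{ extensionality n. exact (cls_tri_pt (eq_trans El (eq_sym E0)) n). }
assert (R1 : pt_map l' = row N1).
{ extensionality n. exact (cls_tri_pt (eq_trans El' (eq_sym E1)) n). }
rewrite R0, R1.
assert (square : forall i j,
  simplex (c := K) (span (row j i :: row j (i + 1) :: row (j + 1) i :: row (j + 1) (i + 1) :: nil))).
{ intros i j.
  apply (simplex_face (c := K) (s := image_of (B := prod_atlas line line) H (Edge i, Edge j))).
  - exists (idx_map H (Edge i, Edge j)). apply morphism_frame, tame_plane.
  - intros z [<-|[<-|[<-|[<-|[]]]]]; apply in_image; simpl; auto.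
  - exists (row j i). now left. }
assert (stable : forall j n, n < M0 \/ M1 < n -> row j n = x).
{ intros j n Hn.
  (* The value at (n, j) is read off the identity arrow at this point. *)
  set (u := @LocalArrow (prod_atlas line line) (Vertex n, Vertex j) (n, j) (n, j)
    (conj eq_refl eq_refl, conj eq_refl eq_refl)).
  destruct Hn as [Hn|Hn].
  - exact (f_equal (@la_src A) (proj1 (Hend u) Hn)).
  - exact (f_equal (@la_src A) (proj2 (Hend u) Hn)). }
assert (loops : forall j, loop_seq (K := K) x (row j)).
{ intros j. split; [|split].
  - intros n. apply (simplex_incl (square n j)); [intros z; simpl; tauto | easy].
  - exists (M0 - 1). intros n Hn. apply stable. lia.
  - exists (M1 + 1). intros n Hn. apply stable. lia. }
assert (step : forall i j, homotopic_seq (K := K) x (row j) (row (j + Z.of_nat i))).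
{ induction i as [|i IH]; intros j.
  - replace (j + Z.of_nat 0) with j by lia. apply rst_refl.
  - eapply rst_trans; [exact (IH j)|]. apply rst_step.
    replace (j + Z.of_nat (S i)) with (j + Z.of_nat i + 1) by lia.
    repeat split; try apply loops. intros n. apply square. }
destruct (Z.le_ge_cases N0 N1) as [h|h].
- replace N1 with (N0 + Z.of_nat (Z.to_nat (N1 - N0))) by lia. apply step.
- apply rst_sym. replace N0 with (N1 + Z.of_nat (Z.to_nat (N0 - N1))) by lia. apply step.
Qed.

Lemma traces_homotopic_seq c w w' : traces c w -> traces c w' -> homotopic_seq (K := K) x w w'.
Proof.
intros (l & hl & hr & <- & Ec) (l' & hl' & hr' & <- & Ec').
assert (H := cls_inj (eq_trans (eq_sym Ec) Ec')).
enough (G : forall p q : path x x, clos_refl_sym_trans _ (@homotopic A x x) p q ->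
  forall l l' : morphism line A, cls (@tri line A) l = proj1_sig p ->
  cls (@tri line A) l' = proj1_sig q -> homotopic_seq (K := K) x l l').
{ exact (G _ _ H l l' eq_refl eq_refl). }
clear. intros p q H; induction H as [p q H|p|p q _ IH|p r q _ IH1 _ IH2]; intros l l' El El'.
- exact (homotopic_homotopic_seq H El El').
- replace (pt_map l') with (pt_map l); [apply rst_refl|].
  extensionality n. exact (cls_tri_pt (eq_trans El (eq_sym El')) n).
- apply rst_sym. now apply IH.
- destruct (proj2_sig r) as (m & _ & _ & Em).
  eapply rst_trans; [apply (IH1 l m) | apply (IH2 m l')]; auto.
Qed.

End SimplyConnected.

(** * The isomorphism *)

Section Transport.
Variables (T U : Type) (G : group_on U) (p : T -> U) (q : U -> T).
Hypothesis pK : forall c, q (p c) = c.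
Hypothesis qK : forall e, p (q e) = e.

Definition transported_group : group_on T.
Proof.
refine (@GroupOn T (fun a b => q (gmul G (p a) (p b))) (q (gone G))
  (fun a => q (ginv G (p a))) _ _ _).
- intros a b c. now rewrite !qK, gmulA.
- intros a. now rewrite qK, gmul1l, pK.
- intros a. now rewrite qK, gmulVl.
Defined.

Lemma transported_group_isomorphism : group_isomorphism transported_group G p.
Proof.
repeat split.
- intros a b. apply qK.
- intros a b H. rewrite <- (pK a), <- (pK b). now f_equal.
- intros e. exists (q e). apply qK.
Qed.
End Transport.

Lemma map_zrange (A : atlas) (w : Z -> A) N M :
  map w (zrange N M) = seg (K := vietoris A) w (N + 1) (Z.to_nat (M - N)).
Proof.
unfold zrange. rewrite map_map. generalize (Z.to_nat (M - N)). intros d.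
transitivity (map (fun i => w (N + Z.of_nat i)) (seq 1 d)); [reflexivity|].
enough (E : forall j, map (fun i => w (N + Z.of_nat i)) (seq j d) =
    seg (K := vietoris A) w (N + Z.of_nat j) d) by exact (E 1%nat).
induction d as [|d IH]; intros j; [reflexivity|]. cbn [seq map seg].
rewrite IH. do 2 f_equal. lia.
Qed.

Lemma spells_zrange (A : atlas) (x : A) (w : Z -> A) N M : N <= M ->
  (forall n, n <= N -> w n = x) -> (forall n, M <= n -> w n = x) ->
  spells (K := vietoris A) x w (map w (zrange N M)).
Proof.
intros H HN HM. exists N, (Z.to_nat (M - N)). repeat split.
- exact HN.
- intros n Hn. apply HM. lia.
- apply map_zrange.
Qed.

Section Comparison.
Variables (A : atlas) (x : A).
Hypothesis infA : infimum A.
Hypothesis scA : forall a : idx A, simply_connected (gpd a).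
Notation K := (vietoris A).

(** The graph of the canonical map. As classes of loops are not functions of a
    chosen representative, the map is obtained from its graph once the latter is
    known to be total and functional; its inverse comes from the same graph. *)
Definition corresponds (c : pi1 x) (e : @edge_pi1 K x) : Prop :=
  exists w (a : @edge_loop K x),
    traces c w /\ loop_seq (K := K) x w /\ spells (K := K) x w (proj1_sig a) /\
    e = cls (@edge_step K x) a.

Lemma corresponds_total c : exists e, corresponds c e.
Proof.
destruct (cls_surj c) as [[C (l & hl & hr & ->)] ->].
assert (Hw := stabilizes_loop_seq hl hr).
destruct (loop_seq_spells Hw) as [s Hs].
exists (cls (@edge_step K x) (exist _ s (spells_walk Hw Hs))), (pt_map l), (exist _ s (spells_walk Hw Hs)).
split; [|split; [exact Hw | split; [exact Hs | reflexivity]]].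
now exists l, hl, hr.
Qed.

Lemma corresponds_surj e : exists c, corresponds c e.
Proof.
destruct (cls_surj e) as [a ->].
assert (Hw := seq_of_loop (K := K) (proj2_sig a)).
destruct (loop_seq_realized infA scA Hw) as (l & hl & hr & El).
exists (loop_class hl hr), (pt_map l), a. rewrite El.
split; [now exists l, hl, hr|]. repeat split; try apply Hw. exact (seq_of_spells (proj2_sig a)).
Qed.

Lemma corresponds_functional c e e' : corresponds c e -> corresponds c e' -> e = e'.
Proof.
intros (w & a & Hc & Hw & Ha & ->) (w' & b & Hc' & Hw' & Hb & ->).
apply (homotopic_seq_edge_class Hw Hw' Ha Hb). exact (traces_homotopic_seq Hc Hc').
Qed.

Lemma corresponds_injective c c' e : corresponds c e -> corresponds c' e -> c = c'.
Proof.
intros (w & a & Hc & Hw & Ha & ->) (w' & b & Hc' & Hw' & Hb & E).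
apply (traces_unique infA scA (w := w')); [|exact Hc'].
apply (traces_homotopic infA scA c (proj2 (homotopic_seq_edge_class Hw Hw' Ha Hb) E)), Hc.
Qed.

Lemma corresponds_trace (l : morphism line A) (hl : stabilizes_left l x)
    (hr : stabilizes_right l x) N M (hNM : N <= M)
    (hN : forall n, n <= N -> l n = x) (hM : forall n, M <= n -> l n = x) :
  corresponds (loop_class hl hr)
    (cls _ (trace_loop hNM (hN N (Z.le_refl N)) (hM M (Z.le_refl M)))).
Proof.
eexists (pt_map l), _. split; [|split; [|split; [|reflexivity]]].
- now exists l, hl, hr.
- now apply stabilizes_loop_seq.
- now apply spells_zrange.
Qed.

(** Here P, N and M, Q are windows outside of which l and m are constant, N and M
    being the places where l is cut and m is pasted. *)
Lemma concatenates_trace (l m k : morphism line A) : concatenates l m k ->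
  stabilizes_left l x -> stabilizes_right l x ->
  stabilizes_left m x -> stabilizes_right m x ->
  exists P N M Q : Z, P <= N /\ M <= Q /\
    (forall n, n <= P -> l n = x) /\ (forall n, N <= n -> l n = x) /\
    (forall n, n <= M -> m n = x) /\ (forall n, Q <= n -> m n = x) /\
    (forall n, n <= N -> k n = l n) /\ (forall n, N <= n -> k n = m (n - N + M)).
Proof.
intros (y & a & b & ha & hb & N & M & Hl & Hm & Hkl & Hkm)
  (a' & ha' & P & HP) (c & hc & S & HS) _ (d & hd & Q & HQ).
assert (src : forall (f g : morphism line A) i j, nth_arrow f i = nth_arrow g j -> f i = g j)
  by (intros f g i j H; exact (f_equal (@la_src A) H)).
assert (Ey : y = x).
{ generalize (f_equal (@la_src A) (Hl (Z.max N (S + 1)) ltac:(lia))).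
  rewrite HS by lia. simpl. congruence. }
subst y.
assert (Hl' : forall n, N <= n -> l n = x) by (intros n Hn; exact (f_equal (@la_src A) (Hl n Hn))).
assert (Hm' : forall n, n <= M -> m n = x).
{ intros n Hn. replace n with (n - 1 + 1) by lia.
  exact (f_equal (@la_tgt A) (Hm (n - 1) ltac:(lia))). }
assert (Hk' : forall n, N <= n -> k n = m (n - N + M)) by (intros n Hn; apply src, Hkm, Hn).
exists (Z.min N (P - 1)), N, M, (Z.max M (Q + 1)).
repeat split; try lia; auto.
- intros n Hn. exact (f_equal (@la_src A) (HP n ltac:(lia))).
- intros n Hn. exact (f_equal (@la_src A) (HQ n ltac:(lia))).
- intros n Hn. destruct (Z.eq_dec n N) as [->|]; [|apply src, Hkl; lia].
  rewrite Hk', Hl' by lia. apply Hm'. lia.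
Qed.

End Comparison.

Theorem theorem4p4p3 (A : atlas) (x : A) (infA : infimum A)
    (scA : forall a : idx A, simply_connected (gpd a)) :
  exists (G : group_on (pi1 x)) (p : pi1 x -> @edge_pi1 (vietoris A) x),
    induced_by_concatenation G /\ canonical_map p /\
    group_isomorphism G (@edge_path_group (vietoris A) x) p.
Proof.
destruct (choice _ (@corresponds_total A x)) as [p Hp].
destruct (choice _ (@corresponds_surj A x infA scA)) as [q Hq].
assert (pE : forall c e, corresponds c e -> p c = e).
{ intros c e H. exact (corresponds_functional (Hp c) H). }
assert (pK : forall c, q (p c) = c).
{ intros c. exact (corresponds_injective infA scA (Hq (p c)) (Hp c)). }
assert (qK : forall e, p (q e) = e) by (intros e; apply pE, Hq).
exists (transported_group (edge_path_group (K := vietoris A) x) pK qK), p.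
assert (pC : canonical_map p) by (intros l hl hr N M hNM hN hM; apply pE, corresponds_trace).
split; [|split; [exact pC | apply transported_group_isomorphism]].
intros l m k hll hlr hml hmr hkl hkr H.
destruct (concatenates_trace H hll hlr hml hmr)
  as (P & N & M & Q & hPN & hMQ & lP & lN & mM & mQ & kl & km).
rewrite <- (pK (loop_class hkl hkr)).
assert (kP : forall n, n <= P -> k n = x) by (intros n Hn; rewrite kl by lia; auto).
assert (kQ : forall n, N + (Q - M) <= n -> k n = x).
{ intros n Hn. rewrite km by lia. apply mQ. lia. }
assert (hPQ : P <= N + (Q - M)) by lia.
simpl. f_equal.
rewrite (pC _ hll hlr _ _ hPN lP lN), (pC _ hml hmr _ _ hMQ mM mQ), (pC _ hkl hkr _ _ hPQ kP kQ).
rewrite quot_map2E. f_equal. apply subset_eq_compat. simpl.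
rewrite !map_zrange.
replace (Z.to_nat (N + (Q - M) - P)) with (Z.to_nat (N - P) + Z.to_nat (Q - M))%nat by lia.
rewrite seg_add. f_equal; apply seg_ext; try reflexivity; intros i Hi.
- symmetry. apply kl. lia.
- rewrite km by lia. f_equal. lia.
Qed.
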